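(* Assume $g_I$ has an isolated singularity at the origin. Let $r>0$, and let $\eta_0>0$ be sufficiently small so that for every $t\in[0,1]$ and every $\eta\in\mathbb{C}$ with $|\eta|\le\eta_0$ the fiber $f_{I,t}^{-1}(\eta)$ and the sphere $S_r^{2n-1}$ intersect transversely. Then: (1) There exists an isotopy $h_t:(S_r^{2n-1},K_{0,r})\to(S_r^{2n-1},K_{t,r})$, $0\le t\le 1$, such that $f_{I,t}(h_t(\mathbf z))=f_{I,0}(\mathbf z)$ for every $t\in[0,1]$ and every $\mathbf z\in S_r^{2n-1}$ with $|f_{I,0}(\mathbf z)|\le\eta_0$. (2) For every $t\in[0,1]$ the Milnor fibrations $$f_{I,0}:\partial E_0(\eta_0,r)\to S^1_{\eta_0},\qquad f_{I,t}:\partial E_t(\eta_0,r)\to S^1_{\eta_0}$$ are $C^\infty$ equivalent.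
   Context: Let $n\ge1$ and let $a_j\ge1$, $b_j\ge0$ be integers for $j=1,\dots,n$. Define functions $\mathbb{C}^n\to\mathbb{C}$ by $$f_I(\mathbf z,\bar{\mathbf z})=z_1^{a_1+b_1}\bar z_1^{b_1}z_2+\cdots+z_{n-1}^{a_{n-1}+b_{n-1}}\bar z_{n-1}^{b_{n-1}}z_n+z_n^{a_n+b_n}\bar z_n^{b_n},$$ $$g_I(\mathbf z)=z_1^{a_1}z_2+\cdots+z_{n-1}^{a_{n-1}}z_n+z_n^{a_n},$$ and $f_{I,t}=(1-t)f_I+t\,g_I$ for $0\le t\le1$. ''Isolated singularity at the origin'' means that the origin is a critical point of $g_I$ and is isolated among its critical points. Put $V_{I,t}=f_{I,t}^{-1}(0)$, $S_r^{2n-1}=\{\mathbf z\in\mathbb{C}^n:\|\mathbf z\|=r\}$, $K_{t,r}=V_{I,t}\cap S_r^{2n-1}$, $S^1_{\eta_0}=\{\eta\in\mathbb{C}:|\eta|=\eta_0\}$, and $$\partial E_t(\eta_0,r)=\{\mathbf z\in\mathbb{C}^n: |f_{I,t}(\mathbf z)|=\eta_0,\ \|\mathbf z\|\le r\}.$$ An isotopy $h_t:(S_r^{2n-1},K_{0,r})\to(S_r^{2n-1},K_{t,r})$ means a family of diffeomorphisms $h_t$ of $S_r^{2n-1}$, depending smoothly on $t\in[0,1]$, with $h_t(K_{0,r})=K_{t,r}$. Two fibrations $p:E\to B$, $p':E'\to B$ are $C^\infty$ equivalent if there is a diffeomorphism $\Phi:E\to E'$ (of manifolds with boundary) with $p'\circ\Phi=p$.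 *)

(* Defs.v *)
From HB Require Import structures.
From mathcomp Require Import all_boot all_order all_algebra.
From mathcomp Require Import all_classical all_reals all_analysis.
From mathcomp Require Import complex.

Set Implicit Arguments.
Unset Strict Implicit.
Unset Printing Implicit Defensive.

Import Order.TTheory GRing.Theory Num.Theory.
Import numFieldNormedType.Exports.

Local Open Scope classical_set_scope.
Local Open Scope complex_scope.
Local Open Scope ring_scope.

(* Smoothness between finite-dimensional real normed spaces.  On an open set U
   of a finite-dimensional space, [Ck k U f] is the usual notion of class C^k:
   iterated directional derivatives up to order k exist and are continuous. *)
Fixpoint Ck (R : realType) (V W : normedModType R) (k : nat) (U : set V)
    (f : V -> W) : Prop :=
  (forall x, U x -> {for x, continuous f}) /\
  (if k is k'.+1 then
     forall v, (forall x, U x -> derivable f x v) /\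
               Ck k' U (fun x => 'D_v f x)
   else True).

(* Smooth maps on an arbitrary subset: locally the restriction of a C^oo map
   defined on an open set.  On an embedded submanifold, possibly with
   boundary, this is smoothness in charts. *)
Definition smooth_map (R : realType) (V W : normedModType R) (A : set V)
    (f : V -> W) : Prop :=
  forall x, A x -> exists (U : set V) (F : V -> W),
    [/\ open U, U x, (forall k, Ck k U F) &
        forall y, A y -> U y -> F y = f y].

Definition diffeomorphism (R : realType) (V W : normedModType R)
    (A : set V) (B : set W) (f : V -> W) : Prop :=
  exists g : W -> V,
    [/\ (forall x, A x -> B (f x) /\ g (f x) = x),
        (forall y, B y -> A (g y) /\ f (g y) = y),
        smooth_map A f & smooth_map B g].

Section Realification.
Variables (R : realType) (n : nat).

(* 'rV[R[i]]_n is a normed space over R[i] only, hence the real differential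
   calculus on C^n is carried out on R^n * R^n. *)
Definition realify (z : 'rV[R[i]]_n) : 'rV[R]_n * 'rV[R]_n :=
  (\row_j complex.Re (z 0 j), \row_j complex.Im (z 0 j)).

Definition complexify (p : 'rV[R]_n * 'rV[R]_n) : 'rV[R[i]]_n :=
  \row_j (p.1 0 j +i* p.2 0 j).

Definition diffeomorphismC (A B : set 'rV[R[i]]_n)
    (h : 'rV[R[i]]_n -> 'rV[R[i]]_n) : Prop :=
  diffeomorphism (realify @` A) (realify @` B) (realify \o h \o complexify).

(* The real differential of f at z, as a map C^n -> R^2. *)
Definition real_diff (f : 'rV[R[i]]_n -> R[i]) (z v : 'rV[R[i]]_n) : R * R :=
  'd (fun p : 'rV[R]_n * 'rV[R]_n =>
        (complex.Re (f (complexify p)), complex.Im (f (complexify p))) : R * R)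
     (realify z) (realify v).

(* The real inner product Re <z, w>, and the Euclidean norm (the library norm
   on row vectors is the sup norm). *)
Definition real_dot (z w : 'rV[R[i]]_n) : R :=
  \sum_(j < n) complex.Re (z 0 j * (w 0 j)^*%C).

Definition enorm (z : 'rV[R[i]]_n) : R := Num.sqrt (real_dot z z).

Definition sphere (r : R) : set 'rV[R[i]]_n := [set z | enorm z = r].

(* T_z f^-1(eta) + T_z S_r = T_z C^n at every common point z, the fiber being
   nonsingular at z so that its tangent space is the kernel of the real
   differential; the tangent space of the sphere is the orthogonal of z. *)
Definition fiber_transverse_sphere (f : 'rV[R[i]]_n -> R[i]) (eta : R[i])
    (r : R) : Prop :=
  forall z, f z = eta -> sphere r z ->
    (forall y : R * R, exists v, real_diff f z v = y) /\
    (forall u, exists v w, [/\ u = v + w, real_diff f z v = 0 &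
                               real_dot z w = 0]).

(* Complex partial derivatives: the derivative is taken over R[i]. *)
Definition critical_point (g : 'rV[R[i]]_n -> R[i]) (z : 'rV[R[i]]_n) : Prop :=
  forall j : 'I_n, 'D_(delta_mx 0 j) (g : 'rV[R[i]]_n -> R[i]^o) z = 0.

Definition isolated_singularity_at_origin (g : 'rV[R[i]]_n -> R[i]) : Prop :=
  critical_point g 0 /\
  (\forall z \near nbhs (0 : 'rV[R[i]^o]_n), critical_point g z -> z = 0).

(* z_{j+1}, with the convention z_{n+1} = 1. *)
Definition next_coord (z : 'rV[R[i]]_n) (j : 'I_n) : R[i] :=
  if insub j.+1 is Some k then z 0 k else 1.

Definition f_I (a b : 'I_n -> nat) (z : 'rV[R[i]]_n) : R[i] :=
  \sum_(j < n) z 0 j ^+ (a j + b j) * (z 0 j)^*%C ^+ b j * next_coord z j.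

Definition g_I (a : 'I_n -> nat) (z : 'rV[R[i]]_n) : R[i] :=
  \sum_(j < n) z 0 j ^+ a j * next_coord z j.

Definition f_It (a b : 'I_n -> nat) (t : R) (z : 'rV[R[i]]_n) : R[i] :=
  (1 - t%:C) * f_I a b z + t%:C * g_I a z.

Definition link (a b : 'I_n -> nat) (t r : R) : set 'rV[R[i]]_n :=
  [set z | f_It a b t z = 0] `&` sphere r.

(* \partial E_t(eta0, r). *)
Definition milnor_tube (a b : 'I_n -> nat) (t eta0 r : R) : set 'rV[R[i]]_n :=
  [set z | `|f_It a b t z| = eta0%:C /\ enorm z <= r].

(* Smooth dependence on t is joint smoothness in (t, z) on [0, 1] * S_r. *)
Definition link_isotopy (a b : 'I_n -> nat) (r : R)
    (h : R -> 'rV[R[i]]_n -> 'rV[R[i]]_n) : Prop :=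
  smooth_map [set q : R * ('rV[R]_n * 'rV[R]_n) |
                0 <= q.1 <= 1 /\ (realify @` sphere r) q.2]
             (fun q => realify (h q.1 (complexify q.2))) /\
  (forall t, 0 <= t <= 1 ->
     diffeomorphismC (sphere r) (sphere r) (h t) /\
     h t @` link a b 0 r = link a b t r).

(* p : E -> B and p' : E' -> B, restrictions of maps defined on C^n. *)
Definition fibrations_equivalent (E E' : set 'rV[R[i]]_n)
    (p p' : 'rV[R[i]]_n -> R[i]) : Prop :=
  exists Phi : 'rV[R[i]]_n -> 'rV[R[i]]_n,
    diffeomorphismC E E' Phi /\ (forall z, E z -> p' (Phi z) = p z).

End Realification.

(* Main.v *)
Require Import Defs.
From HB Require Import structures.
From mathcomp Require Import all_boot all_order all_algebra.
From mathcomp Require Import all_classical all_reals all_analysis.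
From mathcomp Require Import complex.
From mathcomp Require Import ring lra.
Import Order.TTheory GRing.Theory Num.Theory.
Import numFieldNormedType.Exports.
Local Open Scope classical_set_scope.
Local Open Scope complex_scope.
Local Open Scope ring_scope.
Set Implicit Arguments.
Unset Strict Implicit.
Unset Printing Implicit Defensive.

(** Both parts follow from one family of diffeomorphisms [G t] of the closed
    ball of radius [r], smooth in [t] and preserving the sphere, such that
    [f_It t (G t z) = f_It 0 z] for every [z] that lies on the sphere with
    [|f_It 0 z| <= eta0] or lies in the ball with [|f_It 0 z| = eta0]: part (1)
    restricts [G t] to the sphere and part (2) restricts it to the tube.

    Such a family exists because the differential of [f_It t] in [z] is onto at
    these points, even along the sphere at those on it.  On the sphere this is
    transversality.  Inside, it holds at every point where [f_It t] does not
    vanish: a diagonal field [z_j -> c_j z_j] multiplies the term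
    [z_j^(a_j + b_j) * conj z_j ^ b_j * z_(j+1)] by a number, and the equations
    making the derivative of [f_It t] equal to [f_It t] or to [i * f_It t] are
    triangular in the [c_j] ([downward_recursion], [radial_field],
    [angular_field]).  A single Gram determinant [gdet] measures both
    conditions, because [damp] removes the whole radial component exactly on
    the sphere; it is positive on the compact set in question, hence bounded
    below ([gdet_bounded_below]).

    Instead of integrating a vector field, the isotopy is composed of small
    steps.  From time [s] to a nearby time [t], a point [z] moves to
    [z + stereo z (field c (s, z))], where [c] in R^2 is chosen so that the
    value of the map is unchanged; [c] is a fixed point of a contraction, and a
    smooth function of [s], [t] and [z] by [fixed_point_near_compact].  The
    inverse of a step is obtained from the same theorem, and [stereo_sphere]
    shows that a step preserves the sphere and its two sides ([step_maps]).
    The steps of length [t / m], with [m] fixed, compose to a family that is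
    smooth in [t], so that no gluing in time is needed ([isotopy_exists]).

    The calculus used on the way is that of class C^k functions defined by
    iterated directional derivatives: they are totally differentiable
    ([C1_differentiable]), closed under composition ([Ck_comp]), and a fixed
    point of a smooth family of contractions inherits their regularity
    ([fixed_point_Ck]). *)

(** * Functions of class C^k *)

Section CkTheory.
Variable R : realType.
Implicit Types V W Z : normedModType R.

Lemma Ck_continuous V W k (U : set V) (f : V -> W) x :
  Ck k U f -> U x -> {for x, continuous f}.
Proof. by case: k => [|k] [H _]; exact: H. Qed.

Lemma CkW V W k (U : set V) (f : V -> W) : Ck k.+1 U f -> Ck k U f.
Proof.
elim: k f => [|k IH] f /=; first by case.
case=> cf H; split=> // v; case: (H v) => df Hf; split=> //.
exact: IH Hf.
Qed.

Lemma Ck_sub V W k (U U' : set V) (f : V -> W) :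
  U' `<=` U -> Ck k U f -> Ck k U' f.
Proof.
move=> sU; elim: k f => [|k IH] f /= [cf H]; split=> //; try by move=> x /sU /cf.
by move=> v; case: (H v) => df Hf; split; [move=> x /sU /df|exact: IH].
Qed.

Lemma near_open V (U : set V) x (P : V -> Prop) :
  open U -> U x -> (forall y, U y -> P y) -> \forall y \near x, P y.
Proof. by move=> oU Ux H; apply: filterS (open_nbhs_nbhs (conj oU Ux)). Qed.

Let cont_eq V W (U : set V) (f g : V -> W) : open U ->
  (forall x, U x -> f x = g x) -> (forall x, U x -> {for x, continuous f}) ->
  forall x, U x -> {for x, continuous g}.
Proof.
move=> oU fg cf x Ux.
rewrite /prop_for /continuous_at -(fg _ Ux); apply: cvg_trans (cf _ Ux).
by apply: near_eq_cvg; apply: near_open Ux _ => // y Uy; rewrite fg.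
Qed.

Lemma Ck_eq V W k (U : set V) (f g : V -> W) :
  open U -> (forall x, U x -> f x = g x) -> Ck k U f -> Ck k U g.
Proof.
move=> oU; elim: k f g => [|k IH] f g fg [cf H]; split=> //.
- exact: (cont_eq oU fg cf).
- exact: (cont_eq oU fg cf).
move=> v; have [df Hf] := H v.
split; last first.
  apply: IH Hf => x Ux; apply: near_eq_derive; exact: near_open Ux _.
move=> x Ux; have := df x Ux; apply: near_eq_derivable.
by apply: near_open Ux _.
Qed.

Lemma Ck_derive V W k (U : set V) (f : V -> W) v x :
  Ck k.+1 U f -> U x -> derivable f x v.
Proof. by case=> _ /(_ v)[+ _] Ux; apply. Qed.

Lemma CkD V W k (U : set V) (f g : V -> W) : open U ->
  Ck k U f -> Ck k U g -> Ck k U (f \+ g).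
Proof.
move=> oU; elim: k f g => [|k IH] f g [cf Hf] [cg Hg]; split=> //.
- by move=> x Ux; apply: cvgD; [exact: cf|exact: cg].
- by move=> x Ux; apply: cvgD; [exact: cf|exact: cg].
move=> v; have [df Df] := Hf v; have [dg Dg] := Hg v; split.
  by move=> x Ux; apply: derivableD; [exact: df|exact: dg].
apply: Ck_eq (IH _ _ Df Dg) => // x Ux /=.
by rewrite [RHS]deriveD//; [exact: df|exact: dg].
Qed.

Lemma Ck_cst V W k (U : set V) (w : W) : Ck k U (fun=> w).
Proof.
elim: k w => [|k IH] w; split=> //; try by move=> x _; exact: cvg_cst.
move=> v; split; first by move=> x _; exact: derivable_cst.
rewrite (_ : (fun x => 'D_v (fun=> w) x) = fun=> 0)//.
by apply: funext => x; exact: derive_cst.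
Qed.

Lemma is_derive_linear V W (f : {linear V -> W}) x v :
  is_derive x v f (f v).
Proof.
have E : (fun h : R => h^-1 *: ((f \o shift x) (h *: v) - f x)) @ 0^' --> f v.
  apply: cvg_trans (cvg_cst (f v)).
  apply: near_eq_cvg; last first.
  near=> h.
  have h0 : h != 0 by near: h; exact: nbhs_dnbhs_neq.
  by rewrite /= (linearD f) addrK linearZ/= scalerA mulVf// scale1r.
  exact: dnbhs_filter.
apply: DeriveDef; first by apply/cvg_ex; exists (f v).
exact/cvg_lim.
Unshelve. all: end_near. Qed.

Lemma Ck_linear V W k (U : set V) (f : {linear V -> W}) :
  continuous f -> Ck k U f.
Proof.
move=> cf; case: k => [|k]; split=> //; try by move=> x _; exact: cf.
move=> v; split; first by move=> x _; case: (is_derive_linear f x v).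
rewrite (_ : (fun x => 'D_v f x) = fun=> f v); first exact: Ck_cst.
by apply: funext => x; apply: derive_val; exact: is_derive_linear.
Qed.

Lemma is_deriveZf V W (f : V -> R) (g : V -> W) x v df dg :
  {for x, continuous g} ->
  is_derive x v f df -> is_derive x v g dg ->
  is_derive x v (fun y => f y *: g y) (df *: g x + f x *: dg).
Proof.
move=> cg [hf <-] [hg <-] {df dg}.
have E : (fun h : R => h^-1 *: (((fun y => f y *: g y) \o shift x) (h *: v) - f x *: g x)) @ 0^'
     --> 'D_v f x *: g x + f x *: 'D_v g x.
  evar (fg : R -> W); rewrite [X in X @ _](_ : _ = fg) /=; last first.
    rewrite funeqE => h.
    have -> : f (h *: v + x) *: g (h *: v + x) - f x *: g x =
      (f (h *: v + x) - f x) *: g x + f (h *: v + x) *: (g (h *: v + x) - g x).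
      by rewrite scalerBl scalerBr [RHS]addrC addrA subrK.
    rewrite scalerDr scalerA [X in _ + X]scalerA [h^-1 * f _]mulrC.
    by rewrite -[X in _ + X]scalerA /fg.
  apply: cvgD.
    by apply: cvgZr_tmp; exact: hf.
  apply: cvgZ; last exact: hg.
  suff : {for 0, continuous (fun h : R => f(h *: v + x))}.
    by move=> /continuous_withinNx; rewrite scale0r add0r.
  exact/differentiable_continuous/derivable1_diffP/(derivable1P _ _ _).1.
apply: DeriveDef; first by apply/cvg_ex; eexists; exact: E.
exact/cvg_lim.
Qed.

Lemma CkZ V W k (U : set V) (f : V -> R) (g : V -> W) : open U ->
  Ck k U f -> Ck k U g -> Ck k U (fun x => f x *: g x).
Proof.
move=> oU; elim: k f g => [|k IH] f g Hf Hg.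
  by split=> // x Ux; apply: cvgZ; [exact: Ck_continuous Hf Ux|exact: Ck_continuous Hg Ux].
split.
  by move=> x Ux; apply: cvgZ; [exact: Ck_continuous Hf Ux|exact: Ck_continuous Hg Ux].
move=> v.
have D x : U x -> is_derive x v (fun y => f y *: g y)
    ('D_v f x *: g x + f x *: 'D_v g x).
  move=> Ux; apply: is_deriveZf; first exact: Ck_continuous Hg Ux.
    by apply: derivableP; exact: Ck_derive Hf Ux.
  by apply: derivableP; exact: Ck_derive Hg Ux.
split; first by move=> x /D [].
apply: (@Ck_eq _ _ _ _ (fun x => 'D_v f x *: g x + f x *: 'D_v g x)) => //.
  by move=> x /D [_ <-].
apply: CkD => //; apply: IH.
- by case: Hf => _ /(_ v)[].
- exact: CkW.
- exact: CkW.
- by case: Hg => _ /(_ v)[].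
Qed.

Lemma CkM V k (U : set V) (f g : V -> R) : open U ->
  Ck k U f -> Ck k U g -> Ck k U (fun x => f x * g x).
Proof. exact: CkZ. Qed.

Lemma CkN V W k (U : set V) (f : V -> W) : open U ->
  Ck k U f -> Ck k U (fun x => - f x).
Proof.
move=> oU Hf; have := CkZ oU (Ck_cst k U (-1 : R)) Hf.
by congr (Ck _ _ _); apply: funext => x; rewrite scaleN1r.
Qed.

Lemma CkB V W k (U : set V) (f g : V -> W) : open U ->
  Ck k U f -> Ck k U g -> Ck k U (fun x => f x - g x).
Proof. by move=> oU Hf Hg; exact: CkD Hf (CkN oU Hg). Qed.

Lemma Ck_sum V W k (U : set V) (I : Type) (s : seq I) (P : pred I) (F : I -> V -> W) :
  open U -> (forall i, P i -> Ck k U (F i)) ->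
  Ck k U (fun x => \sum_(i <- s | P i) F i x).
Proof.
move=> oU HF; elim: s => [|i s IH].
  have := Ck_cst k U (0 : W); congr (Ck _ _ _).
  by apply: funext => x; rewrite big_nil.
have [Pi|nPi] := boolP (P i); last first.
  move: IH; congr (Ck _ _ _); apply: funext => x.
  by rewrite big_cons (negbTE nPi).
have := CkD oU (HF _ Pi) IH; congr (Ck _ _ _); apply: funext => x.
by rewrite big_cons Pi.
Qed.

Lemma Ck_prod V k (U : set V) (I : Type) (s : seq I) (P : pred I) (F : I -> V -> R) :
  open U -> (forall i, P i -> Ck k U (F i)) ->
  Ck k U (fun x => \prod_(i <- s | P i) F i x).
Proof.
move=> oU HF; elim: s => [|i s IH].
  have := Ck_cst k U (1 : R); congr (Ck _ _ _).
  by apply: funext => x; rewrite big_nil.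
have [Pi|nPi] := boolP (P i); last first.
  move: IH; congr (Ck _ _ _); apply: funext => x.
  by rewrite big_cons (negbTE nPi).
have := CkM oU (HF _ Pi) IH; congr (Ck _ _ _); apply: funext => x.
by rewrite big_cons Pi.
Qed.

Lemma CkX V k (U : set V) (f : V -> R) n : open U ->
  Ck k U f -> Ck k U (fun x => f x ^+ n).
Proof.
move=> oU Hf; have := Ck_prod (index_enum 'I_n) (P := xpredT) oU (fun _ _ => Hf).
congr (Ck _ _ _); apply: funext => x.
by rewrite big_const cardT/= size_enum_ord iter_mulr_1.
Qed.

Lemma CkV V k (U : set V) (f : V -> R) : open U ->
  (forall x, U x -> f x != 0) -> Ck k U f -> Ck k U (fun x => (f x)^-1).
Proof.
move=> oU f0; elim: k => [|k IH] Hf.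
  by split=> // x Ux; apply: cvgV; [exact: f0|exact: Ck_continuous Hf Ux].
split; first by move=> x Ux; apply: cvgV; [exact: f0|exact: Ck_continuous Hf Ux].
move=> v; split.
  by move=> x Ux; apply: derivableV; [exact: f0|exact: Ck_derive Hf Ux].
have Hi := IH (CkW Hf).
apply: (@Ck_eq _ _ _ _ (fun x => (- (f x)^-1 * (f x)^-1) * 'D_v f x)) => //.
  move=> x Ux; rewrite [RHS]deriveV ?f0//; last exact: Ck_derive Hf Ux.
  by rewrite mulNr expr2 invfM.
apply: CkM => //; last by case: Hf => _ /(_ v)[].
by apply: CkM => //; exact: CkN.
Qed.

End CkTheory.

(** * Total differentiability and the chain rule *)

(** [Ck] speaks of directional derivatives only; a finite basis with continuous
    coordinates is what makes them add up to a total differential. *)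
Class basis (R : realType) (V : normedModType R) := Basis {
  bdim : nat;
  bvec : 'I_bdim -> V;
  bcoord : 'I_bdim -> {linear V -> R};
  bcoord_cont : forall i, continuous (bcoord i);
  bdecomp : forall v, v = \sum_i bcoord i v *: bvec i }.
Arguments bcoord {R V basis}.
Arguments bvec {R V basis}.
Arguments bdim {R} V {basis}.
Arguments bcoord_cont {R V basis} i.

Section BasisInstances.
Variable R : realType.

Lemma scalar_decomp (v : R) : v = \sum_(i < 1) idfun v *: (1 : R).
Proof. by rewrite big_ord1 /= [RHS]mulr1. Qed.
Lemma scalar_coord_cont (i : 'I_1) : continuous (idfun : R -> R).
Proof. by move=> x; exact: cvg_id. Qed.
#[export] Instance basis_scalar : basis (R : normedModType R) :=
  @Basis R R 1 (fun=> 1) (fun=> idfun) scalar_coord_cont scalar_decomp.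

Section Coord.
Variables (n : nat) (i : 'I_n).
Definition rV_coord (v : 'rV[R]_n) : R := v 0 i.
Lemma rV_coord_linear : linear rV_coord.
Proof. by move=> c u v; rewrite /rV_coord !mxE. Qed.
HB.instance Definition _ :=
  GRing.isLinear.Build R 'rV[R]_n R _ rV_coord rV_coord_linear.
End Coord.

Lemma rV_decomp n (v : 'rV[R]_n) : v = \sum_i rV_coord i v *: delta_mx 0 i.
Proof. exact: row_sum_delta. Qed.
#[export] Instance basis_rV n : basis 'rV[R]_n :=
  @Basis R 'rV[R]_n n (fun i => delta_mx 0 i) (fun i => @rV_coord n i)
    (fun i => @coord_continuous _ _ _ 0 i) (@rV_decomp n).

Section Pair.
Variables (V W : normedModType R) (bV : basis V) (bW : basis W).
Definition pair_vec (i : 'I_(bdim V + bdim W)) : V * W :=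
  match fintype.split i with inl j => (bvec j, 0) | inr j => (0, bvec j) end.
Definition pair_coord (i : 'I_(bdim V + bdim W)) :
    {linear (V * W)%type -> R} :=
  match fintype.split i with
    inl j => (bcoord j \o fst : {linear (V * W)%type -> R})
  | inr j => (bcoord j \o snd : {linear (V * W)%type -> R}) end.
Lemma pair_coord_cont i : continuous (pair_coord i).
Proof.
rewrite /pair_coord; case: (fintype.split i) => j x /=.
  by apply: continuous_comp; [exact: cvg_fst|exact: bcoord_cont].
by apply: continuous_comp; [exact: cvg_snd|exact: bcoord_cont].
Qed.
Lemma pair_decomp v : v = \sum_i pair_coord i v *: pair_vec i.
Proof.
case: v => v w; rewrite big_split_ord/= /pair_coord /pair_vec.
under eq_bigr do rewrite (unsplitK (inl _)) /= .
under [X in _ + X]eq_bigr do rewrite (unsplitK (inr _)) /= .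
rewrite {1}(bdecomp v) {1}(bdecomp w).
apply/eqP; rewrite -pair_eqE /pair_eq/=; apply/andP; split; apply/eqP.
  rewrite !raddf_sum/= [X in _ + X]big1 ?addr0// => i _; exact: scaler0.
rewrite (raddf_sum snd) (raddf_sum snd)/= [X in X + _]big1 ?add0r// => i _.
exact: scaler0.
Qed.
#[export] Instance basis_prod : basis (V * W)%type :=
  Basis pair_coord_cont pair_decomp.
End Pair.
End BasisInstances.

Section C1.
Variable R : realType.
Implicit Types V W Z : normedModType R.

(** A directional derivative is the derivative of a function of one real
    variable; this gives access to the mean value theorem. *)
Lemma is_derive_line V W (f : V -> W) (x v : V) (u : R) d :
  is_derive (x + u *: v) v f d <->
  is_derive u 1 (fun u : R => f (x + u *: v)) d.
Proof.
set g := fun u : R => f (x + u *: v).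
have E : (fun h : R => h^-1 *: ((f \o shift (x + u *: v)) (h *: v) - f (x + u *: v))) =
  (fun h : R => h^-1 *: ((g \o shift u) (h *: 1) - g u)).
  apply: funext => h; congr (_ *: (f _ - _)) => /=.
  by rewrite [h *: 1]mulr1 scalerDl addrCA.
split => -[H1 H2].
  by split; [rewrite /derivable -E|rewrite /derive -E].
by split; [rewrite /derivable E|rewrite /derive E].
Qed.

Lemma MVT_line V (f : V -> R) (x v : V) (c : R) :
  (forall u : R, `|u| <= `|c| -> derivable f (x + u *: v) v) ->
  exists2 u : R, `|u| <= `|c| &
    f (x + c *: v) - f x = c * 'D_v f (x + u *: v).
Proof.
move=> df; pose g (u : R) := f (x + u *: v).
have dg (u : R) : `|u| <= `|c| -> is_derive u 1 g ('D_v f (x + u *: v)).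
  by move=> /df H; exact: (is_derive_line f x v u _).1 (derivableP H).
have cg (a b : R) : (forall u : R, a <= u <= b -> `|u| <= `|c|) ->
    {within `[a, b], continuous g}.
  move=> H; apply: derivable_within_continuous => u; rewrite in_itv/= => ui.
  exact: (@ex_derive _ _ _ _ _ _ _ (dg u (H u ui))).
have [c0|c0|c0] := ltgtP 0 c.
- have [||u uI E] := MVT c0 (f := g) (df := fun u => 'D_v f (x + u *: v)).
  + by move=> u; rewrite in_itv/= => /andP[u0 uc]; apply: dg; rewrite !gtr0_norm// ltW.
  + by apply: cg => u /andP[u0 uc]; rewrite ger0_norm ?gtr0_norm.
  move: uI; rewrite in_itv/= => /andP[u0 uc]; exists u; first by rewrite !gtr0_norm// ltW.
  by move: E; rewrite /g scale0r addr0 subr0 mulrC.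
- have [||u uI E] := MVT c0 (f := g) (df := fun u => 'D_v f (x + u *: v)).
  + move=> u; rewrite in_itv/= => /andP[u0 uc]; apply: dg.
    by rewrite !ltr0_norm// lerN2 ltW.
  + apply: cg => u /andP[u0 uc]; rewrite ler0_norm ?ltr0_norm//.
    by rewrite lerN2.
  move: uI; rewrite in_itv/= => /andP[u0 uc]; exists u.
    by rewrite !ltr0_norm// lerN2 ltW.
  move: E; rewrite /g scale0r addr0 sub0r => E.
  by rewrite -[LHS]opprB E mulrN opprK mulrC.
- by exists 0; rewrite ?normr0// -c0 scale0r addr0 mul0r subrr.
Qed.

Section Increment.
Context {V : normedModType R} {bV : basis V}.

(** The factor [1 + |bvec i|] bounds a coordinate and the corresponding
    component at the same time. *)
Lemma coord_bound : exists2 C : R, 0 < C &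
  forall h : V, \sum_i `|bcoord i h| * (1 + `|bvec i|) <= C * `|h|.
Proof.
have H i : exists K : R, 0 < K /\ forall h : V, `|bcoord i h| <= K * `|h|.
  by have [K K0 HK] := linear_lipschitz (bcoord_cont i); exists K.
pose K i := projT1 (cid (H i)).
have K0 i : 0 < K i by rewrite /K; case: cid => ? [].
have HK i h : `|bcoord i h| <= K i * `|h| by rewrite /K; case: cid => ? [].
exists (1 + \sum_i K i * (1 + `|bvec i|)).
  by rewrite ltr_wpDr// sumr_ge0// => i _; rewrite mulr_ge0 ?addr_ge0// ltW.
move=> h; rewrite mulrDl mul1r ler_wpDl// mulr_suml; apply: ler_sum => i _.
by rewrite mulrAC ler_wpM2r// addr_ge0.
Qed.

(** The increment is telescoped along the coordinate directions and the mean
    value theorem is applied to each step. *)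
Lemma C1_increment (U : set V) (f : V -> R) x : open U -> U x -> Ck 1 U f ->
  forall e : R, 0 < e -> \forall h \near (0 : V),
    `|f (x + h) - f x - \sum_i bcoord i h * 'D_(bvec i) f x| <= e * `|h|.
Proof.
move=> oU Ux Cf e e0; have [C C0 HC] := coord_bound.
pose e1 := e / C.
have e10 : 0 < e1 by exact: divr_gt0.
have Df : \forall y \near x, forall i, `|'D_(bvec i) f y - 'D_(bvec i) f x| <= e1.
  apply: filter_forall => i.
  have : {for x, continuous (fun y => 'D_(bvec i) f y)}.
    by case: Cf => _ /(_ (bvec i))[_ [H _]]; exact: H.
  by move=> /cvgrPdist_le /(_ _ e10); apply: filterS => y; rewrite distrC.
have [d /= d0 Hd] : exists2 d : R, 0 < d & forall y, `|y - x| < d ->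
    U y /\ forall i, `|'D_(bvec i) f y - 'D_(bvec i) f x| <= e1.
  have : \forall y \near x, U y /\ forall i, `|'D_(bvec i) f y - 'D_(bvec i) f x| <= e1.
    by apply: filterI => //; exact: open_nbhs_nbhs.
  move=> /nbhs_ballP[d /= d0 H]; exists d => // y yx; apply: H.
  by rewrite -ball_normE /= distrC.
apply/nbhs_ballP; exists (d / C) => /=; first exact: divr_gt0.
move=> h; rewrite -ball_normE /= sub0r normrN ltr_pdivlMr// mulrC => hd.
pose p (k : nat) := \sum_(i < @bdim R V bV | (i < k)%N) bcoord i h *: bvec i.
have pS (k : nat) (ck : (k < bdim V)%N) : let i := Ordinal ck in
    p k.+1 = p k + bcoord i h *: bvec i.
  rewrite /p (bigD1 (Ordinal ck)) ?ltnS//= addrC; congr (_ + _).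
  by apply: eq_bigl => i; rewrite ltnS andbC -val_eqE/= ltn_neqAle.
have pb (k : nat) (ck : (k < bdim V)%N) (u : R) : let i := Ordinal ck in
    `|u| <= `|bcoord i h| -> `|p k + u *: bvec i| < d.
  move=> i ui; apply: le_lt_trans hd; apply: le_trans (HC h).
  apply: le_trans (ler_normD _ _) _.
  rewrite (bigD1 i)//= [leLHS]addrC lerD//.
    by rewrite normrZ ler_pM// ler_wpDl.
  apply: le_trans (ler_norm_sum _ _ _) _.
  rewrite big_mkcond [leRHS]big_mkcond/=; apply: ler_sum => j _.
  rewrite -(inj_eq val_inj)/=; case: ltngtP => jk//=; rewrite ?mulr_ge0 ?addr_ge0//.
  by rewrite normrZ ler_pM// ler_wpDl.
(* the telescoping sum over the first [k] coordinate directions *)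
have main (k : nat) : (k <= bdim V)%N ->
  `|f (x + p k) - f x - \sum_(i < bdim V | (i < k)%N) bcoord i h * 'D_(bvec i) f x|
   <= e1 * \sum_(i < bdim V | (i < k)%N) `|bcoord i h|.
  elim: k => [_|k IH ck].
    by rewrite /p !big_pred0// addr0 subrr subr0 normr0 mulr0.
  have {IH} := IH (ltnW ck) => IH.
  pose i := Ordinal ck.
  have S1 (F : 'I_(bdim V) -> R) : \sum_(j < bdim V | (j < k.+1)%N) F j =
      \sum_(j < bdim V | (j < k)%N) F j + F i.
    rewrite (bigD1 i) ?ltnS//= addrC; congr (_ + _).
    by apply: eq_bigl => j; rewrite ltnS andbC -val_eqE/= ltn_neqAle.
  have [u ub E] : exists2 u : R, `|u| <= `|bcoord i h| &
    f (x + p k + bcoord i h *: bvec i) - f (x + p k) =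
      bcoord i h * 'D_(bvec i) f (x + p k + u *: bvec i).
    apply: MVT_line => u ub.
    apply: Ck_derive Cf _; apply: (Hd _ _).1.
    by rewrite addrAC (addrAC x) subrr add0r; exact: pb.
  rewrite pS !S1 addrA mulrDr.
  have -> : f (x + p k + bcoord i h *: bvec i) - f x -
     (\sum_(j < bdim V | (j < k)%N) bcoord j h * 'D_(bvec j) f x + bcoord i h * 'D_(bvec i) f x)
    = (f (x + p k) - f x - \sum_(j < bdim V | (j < k)%N) bcoord j h * 'D_(bvec j) f x) +
      bcoord i h * ('D_(bvec i) f (x + p k + u *: bvec i) - 'D_(bvec i) f x).
    by rewrite mulrBr -E; ring.
  apply: le_trans (ler_normD _ _) _; apply: lerD => //.
  rewrite normrM mulrC ler_wpM2r//; apply: (Hd _ _).2.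
  by rewrite addrAC (addrAC x) subrr add0r; exact: pb.
have pE : p (bdim V) = h.
  rewrite [RHS](bdecomp (h : V)) /p; apply: eq_bigl => i. exact: ltn_ord.
have := main _ (leqnn _); rewrite pE.
have sT (F : 'I_(bdim V) -> R) :
    \sum_(i < bdim V | (i < bdim V)%N) F i = \sum_(i < bdim V) F i.
  by apply: eq_bigl => i; exact: ltn_ord.
rewrite !sT => /le_trans; apply.
rewrite /e1 -mulrA ler_wpM2l ?(ltW e0)// ler_pdivrMl//.
apply: le_trans (HC h); apply: ler_sum => i _.
by rewrite ler_peMr// lerDl.
Qed.

Lemma C1_differentiable_scalar (U : set V) (f : V -> R) x :
  open U -> U x -> Ck 1 U f -> differentiable f x.
Proof.
move=> oU Ux Cf.
pose L (h : V) := \sum_(i < @bdim R V bV) bcoord i h * 'D_(bvec i) f x.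
have L_lin : linear L.
  move=> c u v; rewrite /L scaler_sumr -big_split/=; apply: eq_bigr => i _.
  by rewrite linearP/= mulrDl scalerAl.
pose LM := GRing.isLinear.Build _ _ _ _ _ L_lin.
pose LL : {linear V -> R} := HB.pack L LM.
have cL : continuous LL.
  move=> h; apply: (@Ck_continuous R V R 0 setT) => //.
  apply: Ck_sum => [|i _]; first exact: openT.
  apply: CkM; [exact: openT| |exact: Ck_cst].
  exact/Ck_linear/bcoord_cont.
have E : f \o shift x = cst (f x) + LL +o_ (0 : V) id.
  apply/eqaddoP => e e0; have := C1_increment oU Ux Cf e0.
  apply: filterS => h; rewrite !fctE /= [h + x]addrC /L.
  by rewrite opprD addrA.
have D := diff_unique cL E.
by apply/diff_locallyP; rewrite D; split.
Qed.

End Increment.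

Lemma is_derive_linear_comp V W Z (f : V -> W) (L : {linear W -> Z}) x v d :
  continuous L -> is_derive x v f d -> is_derive x v (L \o f) (L d).
Proof.
move=> cL [df <-].
have E : (fun h : R => h^-1 *: (((L \o f) \o shift x) (h *: v) - (L \o f) x)) @ 0^'
    --> L ('D_v f x).
  have -> : (fun h : R => h^-1 *: (((L \o f) \o shift x) (h *: v) - (L \o f) x))
     = L \o (fun h : R => h^-1 *: ((f \o shift x) (h *: v) - f x)).
    by apply: funext => h /=; rewrite (linearZZ L) (linearB L).
  apply: cvg_comp; [exact: df|exact: cL].
apply: DeriveDef; first by apply/cvg_ex; eexists; exact: E.
exact/cvg_lim.
Qed.

Lemma Ck_linear_comp V W Z k (U : set V) (f : V -> W) (L : {linear W -> Z}) :
  open U -> continuous L -> Ck k U f -> Ck k U (L \o f).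
Proof.
move=> oU cL; elim: k f => [|k IH] f [cf Hf]; split=> //.
- by move=> x Ux; apply: continuous_comp; [exact: cf|exact: cL].
- by move=> x Ux; apply: continuous_comp; [exact: cf|exact: cL].
move=> v; have [df Df] := Hf v.
have D x : U x -> is_derive x v (L \o f) (L ('D_v f x)).
  by move=> Ux; apply: is_derive_linear_comp => //; apply/derivableP/df.
split; first by move=> x /D [].
by apply: Ck_eq (IH _ Df) => // x /D [_ E]; exact: esym E.
Qed.

Lemma Ck_coord V W {bW : basis W} k (U : set V) (f : V -> W) : open U ->
  (forall i, Ck k U (fun x => bcoord i (f x))) -> Ck k U f.
Proof.
move=> oU Cf.
have -> : f = fun x => \sum_i bcoord i (f x) *: bvec i.
  by apply: funext => x; rewrite -bdecomp.
by apply: Ck_sum => // i _; apply: CkZ => //; exact: Ck_cst.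
Qed.

Lemma Ck_pair V W Z {bW : basis W} {bZ : basis Z} k (U : set V)
    (f : V -> W) (g : V -> Z) : open U ->
  Ck k U f -> Ck k U g -> Ck k U (fun x => (f x, g x)).
Proof.
move=> oU Cf Cg; apply: Ck_coord => // i.
rewrite /= /pair_coord; case: fintype.split => j /=.
  exact: (Ck_linear_comp (L := bcoord j) oU (bcoord_cont j) Cf).
exact: (Ck_linear_comp (L := bcoord j) oU (bcoord_cont j) Cg).
Qed.

Lemma C1_differentiable V W {bV : basis V} {bW : basis W} (U : set V)
    (f : V -> W) x : open U -> U x -> Ck 1 U f -> differentiable f x.
Proof.
move=> oU Ux Cf.
have -> : f = \sum_i (fun y => bcoord i (f y) *: bvec i).
  by apply: funext => y; rewrite fct_sumE -bdecomp.
apply: differentiable_sum => i; apply: differentiableZl.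
apply: (C1_differentiable_scalar oU Ux).
exact: (Ck_linear_comp (L := bcoord i) oU (bcoord_cont i) Cf).
Qed.

Lemma is_derive_comp V W Z (f : V -> W) (g : W -> Z) x v d :
  is_derive x v f d -> differentiable g (f x) ->
  is_derive x v (g \o f) ('d g (f x) d).
Proof.
move=> Df dg.
have /is_derive_line/= [H1 H2] : is_derive (x + 0 *: v) v f d.
  by rewrite scale0r addr0.
suff : is_derive (x + 0 *: v) v (g \o f) ('d g (f x) d).
  by rewrite scale0r addr0.
apply/is_derive_line.
pose c (u : R) := f (x + u *: v).
have dc : differentiable c 0 by apply/derivable1_diffP.
have c0 : c 0 = f x by rewrite /c scale0r addr0.
have dgc : differentiable (g \o c) 0.
  by apply: differentiable_comp => //; rewrite c0.
have -> : (fun u => (g \o f) (x + u *: v)) = g \o c by [].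
split; first exact: diff_derivable.
rewrite deriveE// diff_comp//; last by rewrite c0.
have E : 'd c 0 1 = d by rewrite -deriveE.
by rewrite /= c0 E.
Qed.

(** By induction on [k]: the derivative of [g \o f] is a sum of products of
    derivatives of [f] and of compositions of derivatives of [g] with [f]. *)
Lemma Ck_comp V W Z {bW : basis W} {bZ : basis Z} k (U : set V) (U' : set W)
    (f : V -> W) (g : W -> Z) :
  open U -> open U' -> (forall x, U x -> U' (f x)) ->
  Ck k U f -> Ck k U' g -> Ck k U (g \o f).
Proof.
move=> oU oU' fU; elim: k f g fU => [|k IH] f g fU Cf Cg.
  split=> // x Ux; apply: continuous_comp; first exact: Ck_continuous Cf Ux.
  by apply: Ck_continuous Cg _; exact: fU.
split.
  move=> x Ux; apply: continuous_comp; first exact: Ck_continuous Cf Ux.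
  by apply: Ck_continuous Cg _; exact: fU.
move=> v.
have C1 m (X Y : normedModType R) (A : set X) (h : X -> Y) : Ck m.+1 A h -> Ck 1 A h.
  by elim: m => // m IHm /CkW.
have D x : U x -> is_derive x v (g \o f)
    (\sum_i bcoord i ('D_v f x) *: ('D_(bvec i) g \o f) x).
  move=> Ux.
  have dg : differentiable g (f x).
    by apply: (C1_differentiable oU' (fU _ Ux)); exact: C1 Cg.
  apply: (is_derive_eq (is_derive_comp (derivableP (@Ck_derive _ _ _ _ _ _ v _ Cf Ux)) dg)).
  rewrite [in LHS](bdecomp ('D_v f x)) raddf_sum/=.
  by apply: eq_bigr => i _; rewrite linearZ/= (deriveE _ dg).
split; first by move=> x /D [].
apply: (@Ck_eq _ _ _ _ _ (fun x => \sum_i bcoord i ('D_v f x) *: ('D_(bvec i) g \o f) x)) => //.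
  by move=> x /D [_ <-].
have [_ /(_ v)[_ Cf']] := Cf.
apply: Ck_sum => // i _; apply: CkZ => //.
  exact: (Ck_linear_comp (L := bcoord i) oU (bcoord_cont i) Cf').
apply: IH => //; first exact: CkW.
by case: Cg => _ /(_ (bvec i))[].
Qed.

End C1.
(** * Regularity of a fixed point depending on a parameter *)

Section FixedPoint.
Variable R : realType.

Lemma linear_continuous_basis (V W : normedModType R) {bV : basis V}
  (L : {linear V -> W}) : continuous L.
Proof.
move=> x; apply: (@Ck_continuous R V W 0 setT) => //.
have -> : (L : V -> W) = fun v => \sum_i bcoord i v *: L (bvec i).
  apply: funext => v; rewrite {1}(bdecomp v) linear_sum/=.
  by apply: eq_bigr => i _; rewrite linearZ.
apply: Ck_sum => [|i _]; first exact: openT.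
apply: CkZ; [exact: openT| |exact: Ck_cst].
exact/Ck_linear/bcoord_cont.
Qed.

Lemma Ck_id (V : normedModType R) k (U : set V) : Ck k U (fun x => x).
Proof. by apply: (@Ck_linear R V V _ _ idfun) => x; exact: cvg_id. Qed.

Lemma Ck_det (V : normedModType R) k m (U : set V) (M : V -> 'M[R]_m) :
  open U -> (forall i j, Ck k U (fun x => M x i j)) ->
  Ck k U (fun x => \det (M x)).
Proof.
move=> oU CM; rewrite /determinant; apply: Ck_sum => // s _.
apply: CkM => //; first exact: Ck_cst.
by apply: Ck_prod => // i _.
Qed.

Lemma Ck_adj (V : normedModType R) k m (U : set V) (M : V -> 'M[R]_m) i j :
  open U -> (forall i j, Ck k U (fun x => M x i j)) ->
  Ck k U (fun x => (\adj (M x)) i j).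
Proof.
move=> oU CM.
have -> : (fun x => (\adj (M x)) i j) =
    fun x => (-1) ^+ (j + i) * \det (row' j (col' i (M x))).
  by apply: funext => x; rewrite mxE.
apply: CkM => //; first exact: Ck_cst.
apply: Ck_det => // a c.
have -> : (fun x => (row' j (col' i (M x))) a c) = fun x => M x (lift j a) (lift i c).
  by apply: funext => x; rewrite !mxE.
exact: CM.
Qed.

Lemma mx_entry_le m n (M : 'M[R]_(m, n)) i j : `|M i j| <= `|M|.
Proof.
rewrite [in leRHS]/Num.norm/= mx_normrE.
by apply/bigmax_geP; right; exists (i, j).
Qed.

Lemma rV_norm_le m (v : 'rV[R]_m) (c : R) : 0 <= c ->
  (forall j, `|v 0 j| <= c) -> `|v| <= c.
Proof.
move=> c0 H; rewrite [in leLHS]/Num.norm/= mx_normrE.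
by apply: bigmax_le => // -[i j] _ /=; rewrite ord1.
Qed.

(** A minimizer of the displacement over the compact ball is fixed, since
    applying [F] would otherwise halve the displacement. *)
Lemma contraction_fixed_point m (F : 'rV[R]_m -> 'rV[R]_m) (rho : R) :
  0 < rho ->
  (forall y, `|y| <= rho -> `|F y| <= rho) ->
  (forall y y', `|y| <= rho -> `|y'| <= rho ->
     `|F y - F y'| <= 2^-1 * `|y - y'|) ->
  exists2 y, `|y| <= rho & y = F y.
Proof.
move=> rho0 FB FC.
pose A := [set y : 'rV[R]_m | `|y| <= rho].
have A0 : A !=set0 by exists 0; rewrite /A /= normr0 ltW.
have cA : compact A.
  apply: bounded_closed_compact.
    exists rho; split; first exact: num_real.
    by move=> M rM y /= /le_trans; apply; exact: ltW.
  rewrite (_ : A = (fun y : 'rV[R]_m => `|y|) @^-1` [set x | x <= rho])//.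
  by apply: closed_comp => [y _|]; [exact: norm_continuous|exact: closed_le].
have cF : {within A, continuous (fun y => `|F y - y|)}.
  apply/subspace_continuousP => y yA; apply/cvgrPdist_le => e e0.
  have : \forall z \near y, `|y - z| <= e / 2.
    have /cvgrPdist_le : (id z) @[z --> y] --> y by exact: cvg_id.
    by move=> /(_ (e / 2)); apply; exact: divr_gt0.
  rewrite /prop_near1 /within /=; apply: filterS => z yz zA.
  apply: le_trans (ler_dist_dist _ _) _.
  have -> : F y - y - (F z - z) = (F y - F z) - (y - z).
    by rewrite !opprB addrACA [RHS]addrACA [- y + _]addrC.
  have := ler_normB (F y - F z) (y - z); have := FC _ _ yA zA; lra.
have [y /= yA ymin] := compact_EVT_min A0 cA cF.
exists y; first by move: yA; rewrite inE.
have {}yA : `|y| <= rho by move: yA; rewrite inE.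
apply/eqP; rewrite eq_sym -subr_eq0 -normr_eq0; apply/eqP/le_anti.
rewrite normr_ge0 andbT.
have := ymin (F y); rewrite inE /A /= => /(_ (FB _ yA)).
have := FC _ _ (FB _ yA) yA; lra.
Qed.

Section Smoothness.
Context {Q : normedModType R} {bQ : basis Q} {m : nat}.
Local Notation Y := 'rV[R]_m.
Variables (Om : set (Q * Y)) (E : Q * Y -> Y).
Hypotheses (oOm : open Om) (CE : forall k, Ck k Om E).
Variables (O : set Q) (rho : R) (y : Q -> Y).
Hypotheses (oO : open O)
  (Oy : forall q, O q -> [/\ `|y q| < rho, Om (q, y q) & y q = E (q, y q)])
  (Ec : forall q u u', O q -> `|u| <= rho -> `|u'| <= rho ->
     `|E (q, u) - E (q, u')| <= 2^-1 * `|u - u'|).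

Let dE p : Om p -> differentiable E p.
Proof. by move=> Op; exact: (C1_differentiable oOm Op (CE 1)). Qed.

Let B q : 'M[R]_m := lin1_mx (fun w : Y => 'd E (q, y q) (0, w)).

Let B_linear q : linear (fun w : Y => 'd E (q, y q) (0, w)).
Proof.
move=> c u v; rewrite -linearP; congr ('d E _ _).
by congr pair; rewrite /= scaler0 addr0.
Qed.

(** Row vectors act on the left of the partial Jacobian [B q]. *)
Let mulB q (w : Y) : w *m B q = 'd E (q, y q) (0, w).
Proof.
pose LM := GRing.isLinear.Build _ _ _ _ _ (B_linear q).
pose L : {linear Y -> Y} := HB.pack (fun w : Y => 'd E (q, y q) (0, w)) LM.
exact: (mul_rV_lin1 L).
Qed.

Let diff_small q : O q -> forall e : R, 0 < e -> exists2 d : R, 0 < d &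
  forall k : Q * Y, `|k| < d ->
    `|E ((q, y q) + k) - E (q, y q) - 'd E (q, y q) k| <= e * `|k|.
Proof.
move=> Oq e e0; have [_ Op _] := Oy Oq.
have /eqaddoP/(_ e e0) := diff_locally (dE Op).
move=> /nbhs_ballP[d /= d0 H]; exists d => // k kd.
have := H k; rewrite -ball_normE /= sub0r normrN => /(_ kd).
by rewrite !fctE /= [k + _]addrC opprD addrA.
Qed.

(** The Lipschitz bound passes to the partial differential in the unknown,
    because [y q] lies in the open ball. *)
Let B_half q (w : Y) : O q -> `|w *m B q| <= 2^-1 * `|w|.
Proof.
move=> Oq; have [yr Op _] := Oy Oq; rewrite mulB.
apply/ler_addgt0Pr => e e0.
have [->|w0] := eqVneq w 0.
  have -> : 'd E (q, y q) (0, 0 : Y) = 0 by exact: linear0.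
  by rewrite !normr0 mulr0 add0r ltW.
have w0' : 0 < `|w| by rewrite normr_gt0.
have [d d0 Hd] := diff_small Oq (divr_gt0 e0 w0').
pose h := Num.min (d / 2) (rho - `|y q|) / `|w|.
have h0 : 0 < h by rewrite divr_gt0// lt_min divr_gt0// subr_gt0.
have hw : `|h *: w| = Num.min (d / 2) (rho - `|y q|).
  by rewrite normrZ gtr0_norm// /h divfK// gt_eqF.
have hw1 : `|h *: w| <= d / 2 by rewrite hw ge_min lexx.
have hw2 : `|h *: w| <= rho - `|y q| by rewrite hw ge_min lexx orbT.
have kn : `|(0 : Q, h *: w)| = `|h *: w|.
  by rewrite prod_normE /= normr0; apply/max_idPr.
have hwE : `|h *: w| = h * `|w| by rewrite normrZ gtr0_norm.
have H1 : `|E (q, y q + h *: w) - E (q, y q) - h *: 'd E (q, y q) (0, w)| <= h * e.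
  have := Hd (0, h *: w); rewrite kn.
  have -> : (q, y q) + (0, h *: w) = (q, y q + h *: w).
    by congr pair; rewrite /= addr0.
  have -> : 'd E (q, y q) (0, h *: w) = h *: 'd E (q, y q) (0, w).
    by rewrite -linearZ/=; congr ('d E _ _); congr pair; rewrite /= scaler0.
  have -> : e / `|w| * `|h *: w| = h * e.
    by rewrite hwE [h * _]mulrC mulrA divfK ?normr_eq0// mulrC.
  by apply; apply: le_lt_trans hw1 _; rewrite ltr_pdivrMr// ltr_pMr// ltr1n.
have H2 : `|E (q, y q + h *: w) - E (q, y q)| <= 2^-1 * `|h *: w|.
  have := @Ec q (y q + h *: w) (y q) Oq _ (ltW yr).
  rewrite [y q + _]addrC addrK; apply.
  by apply: le_trans (ler_normD _ _) _; lra.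
have H3 : h * `|'d E (q, y q) (0, w)| <= h * (2^-1 * `|w| + e).
  rewrite -[X in X * `|_|](gtr0_norm h0) -normrZ.
  set a := E (q, y q + h *: w) - E (q, y q) in H1 H2 *.
  have := ler_normB a (a - h *: 'd E (q, y q) (0, w)).
  rewrite subKr; lra.
by rewrite ler_pM2l in H3.
Qed.

(** A vector killed by [1 - B] would be at most half as long as itself. *)
Let B_unit q : O q -> 1%:M - B q \in unitmx.
Proof.
move=> Oq; rewrite -row_free_unit -kermx_eq0; apply/rowV0P => w.
move=> /sub_kermxP; rewrite mulmxBr mulmx1 => /eqP; rewrite subr_eq0 => /eqP E1.
have := B_half w Oq; rewrite -E1 => H; apply/eqP; rewrite -normr_le0; lra.
Qed.

Let y_incr q q' : O q -> O q' ->
  `|y q' - y q| <= 2 * `|E (q', y q) - E (q, y q)|.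
Proof.
move=> Oq Oq'; have [yr _ yE] := Oy Oq; have [yr' _ yE'] := Oy Oq'.
have := Ec Oq' (ltW yr') (ltW yr); rewrite -yE' => H.
have := ler_normD (y q' - E (q', y q)) (E (q', y q) - E (q, y q)).
rewrite addrA subrK -yE; lra.
Qed.

Let y_cont q : O q -> {for q, continuous y}.
Proof.
move=> Oq; have [_ Op _] := Oy Oq.
apply/cvgrPdist_le => e e0.
have cE : {for q, continuous (fun q' => E (q', y q))}.
  apply: (@continuous_comp _ _ _ (fun q' => (q', y q)) E).
    apply: (@Ck_continuous R _ _ 0 setT) => //.
    apply: Ck_pair; [exact: openT| |exact: Ck_cst].
    exact: Ck_id.
  exact: Ck_continuous (CE 0) Op.
have : \forall q' \near q, O q' /\ `|E (q, y q) - E (q', y q)| <= e / 2.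
  apply: filterI; first exact: open_nbhs_nbhs.
  by move/cvgrPdist_le : cE; apply; exact: divr_gt0.
apply: filterS => q' [Oq']; have := y_incr Oq Oq'.
by rewrite distrC [X in _ -> X <= _ -> _]distrC; lra.
Qed.

Let yD v q := 'd E (q, y q) (v, 0) *m invmx (1%:M - B q).

(** Solving the linearized equation for the increment of the fixed point. *)
Let y_derive v q : O q -> is_derive q v y (yD v q).
Proof.
move=> Oq; have [yr Op yE] := Oy Oq.
set a := 'd E (q, y q) (v, 0).
pose D (h : R) := y (h *: v + q) - y q.
have Onear : \forall h \near (0 : R), O (h *: v + q).
  have cl : {for (0 : R), continuous (fun h : R => h *: v + q)}.
    by apply: cvgD; [apply: cvgZr_tmp; exact: cvg_id|exact: cvg_cst].
  apply: cl; rewrite scale0r add0r; exact: open_nbhs_nbhs.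
have Esplit h : O (h *: v + q) ->
    E ((q, y q) + (h *: v, D h)) = y (h *: v + q).
  move=> Oh; have [_ _ ->] := Oy Oh; congr E; congr pair => /=.
    by rewrite addrC.
  by rewrite /D addrC subrK.
have dsplit h : 'd E (q, y q) (h *: v, D h) = h *: a + D h *m B q.
  rewrite mulB -linearZ/= -linearD/=; congr ('d E _ _).
  by congr pair; rewrite /= ?scaler0 ?add0r ?addr0.
(* the increment of [y] is at most linear, which lets the remainder be
   measured against [h] alone *)
have Dlip : exists2 C : R, 0 <= C & \forall h \near (0 : R), `|D h| <= C * `|h|.
  have [d d0 Hd] := diff_small Oq ltr01.
  exists (2 * (`|a| + `|v|)); first by rewrite mulr_ge0// addr_ge0.
  have small : \forall h \near (0 : R), `|h *: v| < d.
    have cl : {for (0 : R), continuous (fun h : R => `|h *: v|)}.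
      apply: (@continuous_comp _ _ _ (fun h : R => h *: v)).
        by apply: cvgZr_tmp; exact: cvg_id.
      exact: norm_continuous.
    apply: (cl [set x | x < d]); rewrite scale0r normr0.
    by apply: open_nbhs_nbhs; split; [exact: open_lt|exact: d0].
  apply: filterS2 Onear small => h Oh hd.
  have := y_incr Oq Oh; rewrite -/(D h).
  have kn : `|(h *: v, 0 : Y)| = `|h *: v|.
    by rewrite prod_normE /= normr0; apply/max_idPl.
  have := Hd (h *: v, 0); rewrite kn => /(_ hd).
  have -> : (q, y q) + (h *: v, 0) = (h *: v + q, y q).
    by congr pair; rewrite /= ?addr0// addrC.
  have -> : 'd E (q, y q) (h *: v, 0) = h *: a.
    by rewrite -linearZ/=; congr ('d E _ _); congr pair; rewrite /= scaler0.
  rewrite mul1r -yE normrZ.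
  set F := E (h *: v + q, y q) - y q => H1 H2.
  have := ler_normD (F - h *: a) (h *: a); rewrite subrK normrZ => H3.
  by apply: le_trans H2 _; rewrite mulrDr mulrDl; nra.
have [C C0 HC] := Dlip.
pose r (h : R) := D h - (h *: a + D h *m B q).
have rsmall : h^-1 *: r h @[h --> 0^'] --> (0 : Y).
  apply/cvgr0Pnorm_le => e e0.
  have e10 : 0 < e / (1 + `|v| + C) by rewrite divr_gt0// ltr_wpDr// ltr_wpDr.
  have [d d0 Hd] := diff_small Oq e10.
  have small : \forall h \near (0 : R), (1 + `|v| + C) * `|h| < d.
    have cl : {for (0 : R), continuous (fun h : R => (1 + `|v| + C) * `|h|)}.
      by apply: cvgMl_tmp; exact: norm_continuous.
    apply: (cl [set x | x < d]); rewrite normr0 mulr0.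
    by apply: open_nbhs_nbhs; split; [exact: open_lt|exact: d0].
  near=> h.
  have h0 : h != 0 by near: h; exact: nbhs_dnbhs_neq.
  have Oh : O (h *: v + q) by near: h; exact: nbhs_dnbhs.
  have Hh : `|D h| <= C * `|h| by near: h; exact: nbhs_dnbhs.
  have hs : (1 + `|v| + C) * `|h| < d by near: h; exact: nbhs_dnbhs.
  have kn : `|(h *: v, D h)| <= (1 + `|v| + C) * `|h|.
    rewrite prod_normE /= ge_max normrZ !mulrDl mul1r [`|h| * _]mulrC.
    have := normr_ge0 h; have := normr_ge0 v; move=> ? ?.
    by apply/andP; split; nra.
  have := Hd (h *: v, D h) (le_lt_trans kn hs).
  rewrite Esplit// dsplit -/(r h) -yE -/(D h) -/(r h) => H1.
  rewrite normrZ normfV ler_pdivrMl ?normr_gt0//.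
  apply: le_trans H1 _; apply: le_trans (ler_wpM2l (ltW e10) kn) _.
  have cn0 : 1 + `|v| + C != 0 by rewrite gt_eqF// ltr_wpDr// ltr_wpDr.
  by rewrite mulrA divfK// [X in _ <= X]mulrC.
have U := B_unit Oq.
have DE (h : R) : D h = (h *: a + r h) *m invmx (1%:M - B q).
  have -> : h *: a + r h = D h *m (1%:M - B q).
    by rewrite /r mulmxBr mulmx1 addrCA opprD [h *: a + _]addrA subrr sub0r.
  by rewrite -mulmxA mulmxV// mulmx1.
have L : h^-1 *: D h @[h --> 0^'] --> yD v q.
  have -> : yD v q = mulmxr (invmx (1%:M - B q)) (a + 0) by rewrite addr0.
  have c1 : {for a + 0, continuous (mulmxr (invmx (1%:M - B q)) : Y -> Y)}.
    exact: linear_continuous_basis.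
  have c2 : a + h^-1 *: r h @[h --> 0^'] --> a + 0.
    by apply: cvgD => //; exact: cvg_cst.
  have := cvg_comp _ _ c2 c1; apply: cvg_trans.
  apply: near_eq_cvg; near=> h.
  have h0 : h != 0 by near: h; exact: nbhs_dnbhs_neq.
  rewrite /= DE scalemxAl; congr (_ *m _); rewrite [RHS]scalerDr.
  by congr (_ + _); exact: esym (scalerK h0 a).
apply: DeriveDef; first by apply/cvg_ex; exists (yD v q).
exact/cvg_lim.
Unshelve. all: end_near. Qed.

(** The derivative found above is an algebraic expression in the fixed point
    and the derivatives of the equation, so regularity is gained one order at
    a time. *)
Lemma fixed_point_Ck k : Ck k O y.
Proof.
elim: k => [|k IH]; first by split=> // q; exact: y_cont.
split; first exact: y_cont.
move=> v; split; first by move=> q /(y_derive v) [].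
apply: (@Ck_eq _ _ _ _ _ (yD v)) => //.
  by move=> q /(y_derive v) [_ <-].
have Cg : Ck k O (fun q => (q, y q)).
  by apply: Ck_pair => //; exact: Ck_id.
have Cd w : Ck k O (fun q => 'd E (q, y q) w).
  have : Ck k O ((fun p => 'D_w E p) \o (fun q => (q, y q))).
    apply: (@Ck_comp R _ _ _ _ _ k O Om) => //.
      by move=> q /Oy [].
    by have [_ /(_ w) []] := CE k.+1.
  apply: Ck_eq => // q Oq /=; rewrite deriveE//.
  by apply: dE; have [] := Oy Oq.
have Ce w j : Ck k O (fun q => 'd E (q, y q) w 0 j).
  exact: (Ck_linear_comp (L := @rV_coord R m j) oO (@coord_continuous _ _ _ 0 j) (Cd w)).
have CB i j : Ck k O (fun q => (1%:M - B q) i j).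
  have -> : (fun q => (1%:M - B q) i j) =
     (fun q => (1%:M : 'M[R]_m) i j - 'd E (q, y q) (0, delta_mx 0 i) 0 j).
    by apply: funext => q; rewrite !mxE.
  by apply: CkB => //; exact: Ck_cst.
apply: Ck_coord => // j.
have : Ck k O (fun q => \sum_i 'd E (q, y q) (v, 0) 0 i *
    ((\det (1%:M - B q))^-1 * (\adj (1%:M - B q)) i j)).
  apply: Ck_sum => // i _; apply: CkM => //; apply: CkM => //; last exact: Ck_adj.
  apply: CkV => //; last exact: Ck_det.
  by move=> q /B_unit; rewrite unitmxE unitfE.
apply: Ck_eq => // q Oq; rewrite /= /rV_coord /yD mxE.
by apply: eq_bigr => i _; rewrite /invmx B_unit// !mxE.
Qed.

End Smoothness.

End FixedPoint.
(** * Fixed points near a compact set of parameters *)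

Section FixedPointNearCompact.
Variable R : realType.
Context {Q : normedModType R} {bQ : basis Q} {m : nat}.
Local Notation Y := 'rV[R]_m.
Variables (Om : set (Q * Y)) (E : Q * Y -> Y).
Hypotheses (oOm : open Om) (CE : forall k, Ck k Om E).

(** Small enough for [m] partial derivatives of size [eta] to give the
    Lipschitz constant [1 / 2]; [m.+1] avoids dividing by zero. *)
Let eta : R := 2^-1 / m.+1%:R.
Let good (p : Q * Y) := Om p /\
  forall i : 'I_m, `|'D_((0 : Q, delta_mx 0 i : Y)) E p| <= eta.

Let eta0 : 0 < eta.
Proof. by rewrite /eta divr_gt0// ?ltr0n// invr_gt0. Qed.

(** [MVT_line] looks at both directions from its base point, hence the ball of
    radius [3 * rho]. *)
Let contraction q (rho : R) : (forall u, `|u| <= 3 * rho -> good (q, u)) ->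
  forall u u', `|u| <= rho -> `|u'| <= rho ->
    `|E (q, u) - E (q, u')| <= 2^-1 * `|u - u'|.
Proof.
move=> H u u' ur ur'; apply: rV_norm_le => [|j]; first by rewrite mulr_ge0// invr_ge0.
pose w := u - u'.
have seg (s : R) : `|s| <= `|1 : R| -> good ((q, u') + s *: (0, w)).
  rewrite normr1 => s1.
  have -> : (q, u') + s *: (0 : Q, w) = (q, u' + s *: w).
    by congr pair; rewrite /= scaler0 addr0.
  apply: H; apply: le_trans (ler_normD _ _) _; rewrite normrZ.
  have := ler_normB u u'; rewrite -/w; have := normr_ge0 w; nra.
have [s s1] : exists2 s : R, `|s| <= `|1 : R| &
    E ((q, u') + 1 *: (0, w)) 0 j - E (q, u') 0 j =
    1 * 'D_((0, w)) (fun p => E p 0 j) ((q, u') + s *: (0, w)).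
  apply: (MVT_line (f := fun p => E p 0 j)) => s /seg [Op _].
  apply: (@Ck_derive R _ _ 0 Om) => //.
  exact: (Ck_linear_comp (L := @rV_coord R m j) oOm (@coord_continuous _ _ _ 0 j) (CE 1)).
have -> : (q, u') + 1 *: (0 : Q, w) = (q, u).
  by congr pair; rewrite /= scale1r ?addr0// addrC subrK.
set xi := (q, u') + s *: (0 : Q, w) => Hs; have [Ox Hg] := seg s s1.
rewrite !mxE Hs mul1r.
have dx : differentiable E xi by exact: (C1_differentiable oOm Ox (CE 1)).
have [_ ->] : is_derive xi (0, w) (fun p => E p 0 j) ('D_((0, w)) E xi 0 j).
  apply: (is_derive_linear_comp (L := @rV_coord R m j)).
    exact: (@coord_continuous _ _ _ 0 j).
  by apply: derivableP; exact: diff_derivable.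
apply: le_trans (mx_entry_le _ _ _) _.
have -> : 'D_((0, w)) E xi = \sum_i w 0 i *: 'D_((0 : Q, delta_mx 0 i : Y)) E xi.
  rewrite deriveE//.
  have -> : (0, w) = \sum_i w 0 i *: (0 : Q, delta_mx 0 i : Y).
    apply/eqP; rewrite -pair_eqE /pair_eq/= (raddf_sum fst) (raddf_sum snd)/=.
    apply/andP; split; apply/eqP; last exact: row_sum_delta.
    by rewrite big1// => i _; exact: scaler0.
  rewrite linear_sum/=; apply: eq_bigr => i _.
  by rewrite linearZ/= (deriveE _ dx).
apply: le_trans (ler_norm_sum _ _ _) _.
apply: (@le_trans _ _ (\sum_(i < m) `|w| * eta)).
  apply: ler_sum => i _; rewrite normrZ; apply: ler_pM => //.
  exact: mx_entry_le.
have me : m%:R * eta <= 2^-1.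
  rewrite /eta mulrCA ger_pMr ?invr_gt0// ler_pdivrMr ?ltr0n//.
  by rewrite mul1r ler_nat.
rewrite sumr_const card_ord -mulr_natl -/w; have := normr_ge0 w; nra.
Qed.

Variable C0 : set Q.
Hypotheses (cC0 : compact C0) (Om0 : forall q, C0 q -> Om (q, 0))
  (E0 : forall q, C0 q -> E (q, 0) = 0)
  (dE0 : forall q w, C0 q -> 'D_((0, w)) E (q, 0) = 0).

Let good_near q : C0 q -> \forall p \near nbhs ((q, 0) : (Q * Y)%type), good p.
Proof.
move=> Cq.
have H1 : \forall p \near nbhs ((q, 0) : (Q * Y)%type), Om p.
  by apply: open_nbhs_nbhs; split=> //; exact: Om0.
suff H2 : \forall p \near nbhs ((q, 0) : (Q * Y)%type),
    forall i : 'I_m, `|'D_((0 : Q, delta_mx 0 i : Y)) E p| <= eta.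
  exact: filterI H1 H2.
apply: filter_forall => i.
have [_ /(_ (0, delta_mx 0 i))[_ [/(_ _ (Om0 Cq)) cD _]]] := CE 1.
move/cvgrPdist_le : cD => /(_ _ eta0); apply: filterS => p.
by rewrite dE0// sub0r normrN.
Qed.

(** The partial differential is small near each point [(q, 0)] with [q] in
    [C0], hence by compactness on one ball for all nearby parameters, which
    [E] contracts into itself. *)
Lemma fixed_point_near_compact : exists (O : set Q) (y : Q -> Y) (rho : R),
  [/\ open O, C0 `<=` O, 0 < rho, (forall k, Ck k O y) &
   forall q, O q -> [/\ `|y q| < rho, Om (q, y q), y q = E (q, y q) &
     forall u, `|u| <= rho -> u = E (q, u) -> u = y q]].
Proof.
have [rho rho0 Hrho] : exists2 rho : R, 0 < rho & C0 `<=` [set q |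
    \forall q' \near q, forall u, `|u| <= 3 * rho -> good (q', u)].
  pose P (rho : R) (q : Q) := \forall q' \near q, forall u, `|u| <= 3 * rho -> good (q', u).
  have H : \forall rho \near (0:R)^'+, C0 `<=` P rho.
    apply: ((compact_near_coveringP C0).1 cC0 R (0^'+) P) => q Cq.
    have [[A1 A2] /= [nA1 nA2] HA] := good_near Cq.
    have [d /= d0 Hd] := (nbhs_ballP _ _).1 nA2.
    exists (interior A1, [set rho : R | rho < d / 3 /\ 0 < rho]) => /=.
      split; first exact: nbhs_interior.
      apply: filterI; last exact: nbhs_right_gt.
      by apply: nbhs_right_lt; exact: divr_gt0.
    move=> [q' rho] /= [A1q' [rd r0]]; apply: filterS A1q' => q'' Aq'' u ur.
    apply: (HA (q'', u)); split=> //=; apply: Hd.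
    by rewrite -ball_normE /= sub0r normrN; apply: le_lt_trans ur _; lra.
  have H0 : \forall rho \near (0:R)^'+, 0 < rho by exact: nbhs_right_gt.
  have H2 : \forall rho \near (0:R)^'+, C0 `<=` P rho /\ 0 < rho.
    exact: filterI H H0.
  have H3 := @filter_ex _ (0 : R)^'+ _ _ H2.
  by have [rho [? ?]] := H3; exists rho.
pose O := interior [set q | (forall u, `|u| <= 3 * rho -> good (q, u)) /\
  `|E (q, 0)| <= rho / 4].
pose y q := xget 0 [set u : Y | `|u| < rho /\ u = E (q, u)].
have Og q : O q -> (forall u, `|u| <= 3 * rho -> good (q, u)) /\
  `|E (q, 0)| <= rho / 4 by exact: interior_subset.
have OC q : O q -> forall u u', `|u| <= rho -> `|u'| <= rho ->
    `|E (q, u) - E (q, u')| <= 2^-1 * `|u - u'|.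
  by move=> /Og [Hg _]; exact: contraction.
have Oy q : O q -> `|y q| < rho /\ y q = E (q, y q).
  move=> Oq; have [Hg He] := Og _ Oq.
  suff H : exists u : Y, `|u| < rho /\ u = E (q, u).
    exact: (@xgetPex _ 0 [set u : Y | `|u| < rho /\ u = E (q, u)] H).
  have b u : `|u| <= rho -> `|E (q, u)| <= 3 / 4 * rho.
    move=> ur; have := OC _ Oq u 0 ur; rewrite normr0 => /(_ (ltW rho0)).
    rewrite subr0 => H.
    have := ler_normD (E (q, u) - E (q, 0)) (E (q, 0)); rewrite subrK; lra.
  have [||u ur uE] := @contraction_fixed_point R m (fun u => E (q, u)) rho rho0.
  - by move=> u /b; lra.
  - exact: OC.
  - by exists u; split=> //; rewrite uE; have := b _ ur; lra.
have oO : open O by exact: open_interior.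
exists O, y, rho; split=> //.
- move=> q Cq; apply: filterI; first exact: Hrho.
  have cE : {for q, continuous (fun q' => E (q', 0))}.
    apply: (@continuous_comp _ _ _ (fun q' : Q => (q', 0 : Y)) E).
      apply: (@Ck_continuous R _ _ 0 setT) => //.
      by apply: Ck_pair; [exact: openT|exact: Ck_id|exact: Ck_cst].
    exact: Ck_continuous (CE 0) (Om0 Cq).
  move/cvgrPdist_le : cE => /(_ (rho / 4)); rewrite divr_gt0// => /(_ isT).
  by apply: filterS => q' /=; rewrite (E0 Cq) sub0r normrN.
- move=> k; apply: (@fixed_point_Ck R Q _ m Om E oOm CE O rho y oO _ (fun q u u' Oq => OC q Oq u u')) => q Oq.
  have [yr yE] := Oy _ Oq; split=> //.
  by apply: (((Og _ Oq).1 _ _).1); lra.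
move=> q Oq; have [yr yE] := Oy _ Oq; split=> //.
  by apply: (((Og _ Oq).1 _ _).1); lra.
move=> u ur uE; have := OC _ Oq u (y q) ur (ltW yr); rewrite -uE -yE => H.
apply/eqP; rewrite -subr_eq0 -normr_le0; have := normr_ge0 (u - y q); lra.
Qed.

End FixedPointNearCompact.
(** * A smooth extension of the reciprocal *)

Section Flat.
Variable R : realType.

(** The powers of [1 / x] make the family closed under differentiation. *)
Definition flat (m : nat) (x : R) : R :=
  if 0 < x then expR (- x^-1) * x^-1 ^+ m else 0.

Lemma flat_ge0 m x : 0 <= flat m x.
Proof.
rewrite /flat; case: ifPn => // x0.
by rewrite mulr_ge0 ?expR_ge0// exprn_ge0// invr_ge0 ltW.
Qed.

Lemma flat0_gt0 x : 0 < x -> 0 < flat 0 x.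
Proof. by rewrite /flat => ->; rewrite expr0 mulr1 expR_gt0. Qed.

Lemma flat_le0 m x : x <= 0 -> flat m x = 0.
Proof. by rewrite /flat leNgt => /negbTE ->. Qed.

(** With [flat_bound], this shows that [flat m] is of order two at [0], so its
    derivative there vanishes. *)
Lemma flat_mulS m x : flat m x = x * flat m.+1 x.
Proof.
rewrite /flat; case: ifPn => x0; last by rewrite mulr0.
by rewrite exprS mulrCA [x * (_ * _)]mulrA mulfV ?gt_eqF// mul1r.
Qed.

Lemma flat_bound m x : flat m x <= m.+1`!%:R * `|x|.
Proof.
rewrite /flat; case: ifPn => x0; last by rewrite mulr_ge0.
have y0 : 0 < x^-1 by rewrite invr_gt0.
have := expR_ge1Dxn m (ltW y0) => H.
have F0 : (0 : R) < m.+1`!%:R by rewrite ltr0n fact_gt0.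
have {}H : x^-1 ^+ m.+1 <= m.+1`!%:R * expR x^-1.
  by rewrite mulrC -ler_pdivrMr//; apply: le_trans H; rewrite lerDr.
rewrite expRN (gtr0_norm x0) mulrC ler_pdivrMr ?expR_gt0//.
have -> : x^-1 ^+ m = x^-1 ^+ m.+1 * x.
  by rewrite exprSr -mulrA mulVf ?mulr1// gt_eqF.
by rewrite mulrAC ler_wpM2r// ltW.
Qed.

Lemma is_derive_flat m (x v : R) :
  is_derive x v (flat m) (v * (flat m.+2 x - m%:R * flat m.+1 x)).
Proof.
have [x0|x0|<-] := ltgtP 0 x.
- have En : \forall y \near x, expR (- y^-1) * y^-1 ^+ m = flat m y.
    have : \forall y \near x, 0 < y by exact: lt_nbhsr.
    by apply: filterS => y y0; rewrite /flat y0.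
  apply: near_eq_is_derive En _.
  have D1 : is_derive x v (fun y => y^-1) (- x^-1 ^+ 2 * v).
    have x0' : id x != 0 by rewrite gt_eqF.
    have did : derivable id x v by exact: derivable_id.
    split; first exact: (derivableV x0' did).
    have := deriveV x0' did; rewrite derive_id => ->.
    by rewrite exprVn.
  have D2 : is_derive x v (fun y => expR (- y^-1)) (x^-1 ^+ 2 * v * expR (- x^-1)).
    have DN : is_derive x v (fun y => - y^-1) (- (- x^-1 ^+ 2 * v)).
      exact: is_deriveN.
    have dexp (z : R) : differentiable expR z.
      by apply/derivable1_diffP; case: (is_derive_expR z).
    apply: (is_derive_eq (is_derive_comp (g := expR) DN (dexp _))).
    by rewrite diff1E// derive1E derive_val mulNr opprK.
  have D3 : is_derive x v (fun y => y^-1 ^+ m) (m%:R * x^-1 ^+ m.-1 * (- x^-1 ^+ 2 * v)).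
    have := is_deriveX m D1; congr (is_derive _ _ _ _).
    by apply: funext => y; rewrite exprfctE.
  apply: (is_derive_eq (is_deriveM D2 D3)).
  rewrite /flat x0 ![_ *: _]mulrC.
  set e := expR _; set y := x^-1; case: m {D3} => [|m] /=; first by ring.
  by rewrite !exprS; ring.
- have En : \forall y \near x, 0 = flat m y.
    have : \forall y \near x, y < 0 by exact: lt_nbhsl.
    by apply: filterS => y y0; rewrite flat_le0// ltW.
  apply: near_eq_is_derive En _.
  rewrite !(flat_le0 _ (ltW x0)) mulr0 subr0 mulr0; exact: is_derive_cst.
rewrite !flat_le0// mulr0 subr0 mulr0.
have E : (fun h : R => h^-1 *: ((flat m \o shift 0) (h *: v) - flat m 0)) @ 0^' --> (0 : R).
  apply/cvgr0Pnorm_le => e e0.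
  pose C : R := m.+2`!%:R * `|v| ^+ 2.
  have C0 : 0 <= C by rewrite mulr_ge0.
  have small : \forall h \near (0 : R), C * `|h| < e.
    have cl : {for (0 : R), continuous (fun h : R => C * `|h|)}.
      by apply: cvgMl_tmp; exact: norm_continuous.
    apply: (cl [set x | x < e]); rewrite normr0 mulr0.
    by apply: open_nbhs_nbhs; split; [exact: open_lt|exact: e0].
  near=> h.
  have h0 : h != 0 by near: h; exact: nbhs_dnbhs_neq.
  have hs : C * `|h| < e by near: h; exact: nbhs_dnbhs.
  rewrite /= addr0 (flat_le0 _ (lexx 0)) subr0 flat_mulS.
  rewrite -[h *: v]/(h * v) -[_ *: _]/(_ * _) !mulrA mulVf// mul1r normrM.
  rewrite (ger0_norm (flat_ge0 _ _)); apply: le_trans (ltW hs).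
  apply: le_trans (ler_wpM2l (normr_ge0 v) (flat_bound _ _)) _.
  by rewrite normrM /C le_eqVlt; apply/orP; left; apply/eqP; ring.
apply: DeriveDef; first by apply/cvg_ex; exists 0.
exact/cvg_lim.
Unshelve. all: end_near. Qed.

Lemma Ck_flat k m (U : set R) : Ck k U (flat m).
Proof.
have Df m' x v := is_derive_flat m' x v.
have cf m' x : {for x, continuous (flat m')}.
  by apply/differentiable_continuous/derivable1_diffP; case: (Df m' x 1).
apply: (@Ck_sub _ _ _ _ setT) => //.
elim: k m => [|k IH] m; first by split=> // x _; exact: cf.
split=> [x _|v]; first exact: cf.
split; first by move=> x _; case: (Df m x v).
have -> : (fun x => 'D_v (flat m) x) = fun x => v * (flat m.+2 x - m%:R * flat m.+1 x).
  by apply: funext => x; case: (Df m x v).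
apply: CkM; [exact: openT|exact: Ck_cst|].
apply: CkB; [exact: openT|exact: IH|].
by apply: CkM; [exact: openT|exact: Ck_cst|exact: IH].
Qed.

(** The flat term vanishes for [delta <= x], where this is the reciprocal of
    [x], and keeps the denominator positive for [x < delta]. *)
Definition cutoff_inv (delta x : R) : R := x / (x ^+ 2 + flat 0 (delta - x)).

Lemma cutoff_invE delta x : 0 < delta -> delta <= x -> x * cutoff_inv delta x = 1.
Proof.
move=> d0 dx; rewrite /cutoff_inv flat_le0 ?subr_le0// addr0 mulrA -expr2.
by rewrite mulfV// expf_neq0// gt_eqF// (lt_le_trans d0).
Qed.

Lemma Ck_cutoff_inv delta k (U : set R) : 0 < delta -> Ck k U (cutoff_inv delta).
Proof.
move=> d0; apply: (@Ck_sub _ _ _ _ setT) => //.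
have oT := @openT R.
apply: CkM => //; first exact: Ck_id.
apply: CkV => //.
  move=> x _; have [xd|dx] := ltP x delta.
    by rewrite gt_eqF// ltr_wpDl ?sqr_ge0// flat0_gt0// subr_gt0.
  by rewrite gt_eqF// ltr_pwDl ?flat_ge0// exprn_gt0// (lt_le_trans d0).
apply: CkD => //; first by apply: CkX => //; exact: Ck_id.
have Cs : Ck k setT (fun x : R => delta - x).
  by apply: CkB => //; [exact: Ck_cst|exact: Ck_id].
by apply: (Ck_comp (U' := setT) (g := flat 0) oT oT _ Cs) => //; exact: Ck_flat.
Qed.

End Flat.
(** * Smooth maps on the whole space *)

Section Smooth.
Variable R : realType.
Implicit Types V W Z : normedModType R.

Definition smooth V W (f : V -> W) := forall k, Ck k setT f.

Lemma smooth_cst V W (w : W) : smooth (fun _ : V => w).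
Proof. by move=> k; exact: Ck_cst. Qed.

Lemma smooth_id V : smooth (fun x : V => x).
Proof. by move=> k; exact: Ck_id. Qed.

Lemma smoothD V W (f g : V -> W) : smooth f -> smooth g -> smooth (fun x => f x + g x).
Proof. by move=> Hf Hg k; apply: CkD; [exact: openT|exact: Hf|exact: Hg]. Qed.

Lemma smoothN V W (f : V -> W) : smooth f -> smooth (fun x => - f x).
Proof. by move=> Hf k; apply: CkN; [exact: openT|exact: Hf]. Qed.

Lemma smoothB V W (f g : V -> W) : smooth f -> smooth g -> smooth (fun x => f x - g x).
Proof. by move=> Hf Hg; apply: smoothD => //; exact: smoothN. Qed.

Lemma smoothZ V W (f : V -> R) (g : V -> W) :
  smooth f -> smooth g -> smooth (fun x => f x *: g x).
Proof. by move=> Hf Hg k; apply: CkZ; [exact: openT|exact: Hf|exact: Hg]. Qed.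

Lemma smoothM V (f g : V -> R) : smooth f -> smooth g -> smooth (fun x => f x * g x).
Proof. exact: smoothZ. Qed.

Lemma smoothV V (f : V -> R) : (forall x, f x != 0) -> smooth f ->
  smooth (fun x => (f x)^-1).
Proof. by move=> f0 Hf k; apply: CkV => //; exact: openT. Qed.

Lemma smooth_sum V W (I : Type) (s : seq I) (P : pred I) (F : I -> V -> W) :
  (forall i, P i -> smooth (F i)) -> smooth (fun x => \sum_(i <- s | P i) F i x).
Proof. by move=> HF k; apply: Ck_sum => [|i Pi]; [exact: openT|exact: HF]. Qed.

Lemma smooth_comp V W Z {bW : basis W} {bZ : basis Z} (f : V -> W) (g : W -> Z) :
  smooth f -> smooth g -> smooth (fun x => g (f x)).
Proof.
move=> Hf Hg k.
by apply: (Ck_comp (U' := setT) _ _ _ (Hf k) (Hg k)) => //; exact: openT.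
Qed.

Lemma smooth_pair V W Z {bW : basis W} {bZ : basis Z} (f : V -> W) (g : V -> Z) :
  smooth f -> smooth g -> smooth (fun x => (f x, g x)).
Proof. by move=> Hf Hg k; apply: Ck_pair; [exact: openT|exact: Hf|exact: Hg]. Qed.

Lemma smooth_fst V W : smooth (@fst V W).
Proof.
by move=> k; apply: (@Ck_linear R _ _ _ _ fst) => x; exact: cvg_fst.
Qed.

Lemma smooth_snd V W : smooth (@snd V W).
Proof.
by move=> k; apply: (@Ck_linear R _ _ _ _ snd) => x; exact: cvg_snd.
Qed.

Lemma smooth_fun1 V W Z (f : V -> W * Z) {bW : basis W} {bZ : basis Z} :
  smooth f -> smooth (fun x => (f x).1).
Proof. by move=> Hf; apply: (smooth_comp Hf); exact: smooth_fst. Qed.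

Lemma smooth_fun2 V W Z (f : V -> W * Z) {bW : basis W} {bZ : basis Z} :
  smooth f -> smooth (fun x => (f x).2).
Proof. by move=> Hf; apply: (smooth_comp Hf); exact: smooth_snd. Qed.

Lemma smooth_derive V W (f : V -> W) v : smooth f -> smooth (fun x => 'D_v f x).
Proof. by move=> Hf k; have [_ /(_ v)[]] := Hf k.+1. Qed.

Lemma smooth_entry V n (f : V -> 'rV[R]_n) j : smooth f -> smooth (fun x => f x 0 j).
Proof.
move=> Hf k.
exact: (Ck_linear_comp (L := @rV_coord R n j) openT (@coord_continuous _ _ _ 0 j) (Hf k)).
Qed.

Lemma smooth_row V n (f : V -> 'rV[R]_n) :
  (forall j, smooth (fun x => f x 0 j)) -> smooth f.
Proof. by move=> Hf k; apply: Ck_coord => [|j]; [exact: openT|exact: Hf]. Qed.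

Lemma smooth_Ck V W k (U : set V) (f : V -> W) : smooth f -> Ck k U f.
Proof. by move=> Hf; exact: (Ck_sub _ (Hf k)). Qed.

Lemma smooth_continuous V W (f : V -> W) : smooth f -> continuous f.
Proof. by move=> Hf x; exact: Ck_continuous (Hf 0%N) I. Qed.

Lemma smooth_differentiable V W {bV : basis V} {bW : basis W} (f : V -> W) x :
  smooth f -> differentiable f x.
Proof. by move=> Hf; exact: (C1_differentiable openT I (Hf 1)). Qed.

End Smooth.

(** * Fields dual to the differentials and tangent to the sphere *)

Section Dot.
Variables (R : realType) (N : nat).
Implicit Types u v w : 'rV[R]_N.

Definition dot u v : R := \sum_j u 0 j * v 0 j.

Lemma dotC u v : dot u v = dot v u.
Proof. by apply: eq_bigr => j _; rewrite mulrC. Qed.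

Lemma dotDl u v w : dot (u + v) w = dot u w + dot v w.
Proof. by rewrite -big_split; apply: eq_bigr => j _; rewrite mxE mulrDl. Qed.

Lemma dotZl c u w : dot (c *: u) w = c * dot u w.
Proof. by rewrite mulr_sumr; apply: eq_bigr => j _; rewrite mxE mulrA. Qed.

Lemma dotNl u w : dot (- u) w = - dot u w.
Proof. by rewrite -scaleN1r dotZl mulN1r. Qed.

Lemma dotDr u v w : dot w (u + v) = dot w u + dot w v.
Proof. by rewrite dotC dotDl !(dotC w). Qed.

Lemma dotZr c u w : dot w (c *: u) = c * dot w u.
Proof. by rewrite dotC dotZl (dotC w). Qed.

Lemma dotNr u w : dot w (- u) = - dot w u.
Proof. by rewrite dotC dotNl (dotC w). Qed.

Definition dotE := (dotDl, dotDr, dotZl, dotZr, dotNl, dotNr).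

Lemma dot_ge0 u : 0 <= dot u u.
Proof. by apply: sumr_ge0 => j _; rewrite -expr2 sqr_ge0. Qed.

Lemma dot_eq0 u : dot u u = 0 -> u = 0.
Proof.
move=> /eqP; rewrite psumr_eq0 => [/allP H|j _]; last by rewrite -expr2 sqr_ge0.
apply/rowP => j; rewrite mxE; apply/eqP.
by have := H j (mem_index_enum _); rewrite /= -expr2 sqrf_eq0.
Qed.

Lemma smooth_dot (V : normedModType R) (f g : V -> 'rV[R]_N) :
  smooth f -> smooth g -> smooth (fun x => dot (f x) (g x)).
Proof.
move=> Hf Hg; apply: smooth_sum => j _.
by apply: smoothM; exact: smooth_entry.
Qed.

End Dot.

Section Fields.
Variables (R : realType) (N : nat).
Local Notation V := 'rV[R]_N.
Variables (F : R * V -> 'rV[R]_2) (r : R).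
Hypotheses (sF : smooth F) (r0 : 0 < r).

Definition grad (k : 'I_2) (p : R * V) : V :=
  \row_j 'D_((0, delta_mx 0 j)) F p 0 k.

Lemma smooth_grad k : smooth (grad k).
Proof.
apply: smooth_row => j.
have -> : (fun x => grad k x 0 j) = (fun x => 'D_((0, delta_mx 0 j)) F x 0 k).
  by apply: funext => x; rewrite mxE.
by apply: smooth_entry; exact: smooth_derive.
Qed.

Lemma dot_grad k p v : dot (grad k p) v = 'D_((0, v)) F p 0 k.
Proof.
have dF : differentiable F p by exact: smooth_differentiable.
rewrite (deriveE _ dF).
have -> : (0, v) = \sum_j v 0 j *: (0 : R, delta_mx 0 j : V).
  apply/eqP; rewrite -pair_eqE /pair_eq/= (raddf_sum fst) (raddf_sum snd)/=.
  apply/andP; split; apply/eqP; last exact: row_sum_delta.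
  by rewrite big1// => i _; exact: scaler0.
rewrite linear_sum/= summxE; apply: eq_bigr => j _.
by rewrite linearZ/= !mxE (deriveE _ dF) mulrC.
Qed.

(** [damp z] multiplies the radial component of a vector by
    [(1 - |z|^2 / r^2)^2]: a polynomial in [z] that removes this component
    exactly when [z] lies on the sphere of radius [r]. *)
Definition radial_coef (z : V) : R := (2 * r ^+ 2 - dot z z) / r ^+ 4.
Definition damp (z v : V) : V := v - (radial_coef z * dot z v) *: z.

Lemma dot_damp z v : dot z (damp z v) = (1 - dot z z / r ^+ 2) ^+ 2 * dot z v.
Proof.
rewrite /damp /radial_coef !dotE; have rn0 : r != 0 by rewrite gt_eqF.
by field.
Qed.

Definition gram (i j : 'I_2) (p : R * V) : R := dot (grad i p) (damp p.2 (grad j p)).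

Lemma gramC i j p : gram i j p = gram j i p.
Proof.
rewrite /gram /damp !dotE [dot (grad i p) p.2]dotC [dot (grad j p) p.2]dotC.
by rewrite [dot (grad i p) _]dotC; ring.
Qed.

Definition gdet (p : R * V) : R := gram 0 0 p * gram 1 1 p - gram 0 1 p ^+ 2.

Variable delta : R.
Hypothesis delta0 : 0 < delta.

(** Cramer's rule for the combination of damped gradients on which the
    differential of [F] takes the value [c].  The cut-off makes it smooth
    everywhere and leaves it exact where the determinant is at least
    [delta]. *)
Definition field (c : 'rV[R]_2) (p : R * V) : V :=
  cutoff_inv delta (gdet p) *:
   ((c 0 0 * gram 1 1 p - c 0 1 * gram 0 1 p) *: damp p.2 (grad 0 p) +
    (c 0 1 * gram 0 0 p - c 0 0 * gram 0 1 p) *: damp p.2 (grad 1 p)).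

Lemma dot_grad_field c k p :
  dot (grad k p) (field c p) = gdet p * cutoff_inv delta (gdet p) * c 0 k.
Proof.
rewrite /field dotZr dotDr !dotZr -!/(gram _ _ _).
have [->|->] : k = 0 \/ k = 1.
  by case: k => [[|[|//]]] lk; [left|right]; exact: val_inj.
  by rewrite /gdet; ring.
by rewrite (gramC 1 0) /gdet; ring.
Qed.

Definition stereo_ratio (y : V) : R := dot y y / (4 * r ^+ 2).

(** For [z] on the sphere and [y] tangent to it at [z], the point
    [z + stereo z y] is the image of [y] under stereographic projection from
    [- z]; no square root is needed, and the formula makes sense for all [z]
    and [y]. *)
Definition stereo (z y : V) : V :=
  (1 + stereo_ratio y)^-1 *: (y - (2 * stereo_ratio y) *: z).

Lemma stereo_ratio_ge0 y : 0 <= stereo_ratio y.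
Proof. by rewrite divr_ge0 ?dot_ge0// mulr_ge0 ?sqr_ge0. Qed.

Lemma stereo_ratio1_neq0 y : 1 + stereo_ratio y != 0.
Proof. by rewrite gt_eqF// ltr_pwDl// stereo_ratio_ge0. Qed.

(** The radial part of [field c p], without the factor that vanishes on the
    sphere. *)
Definition field_dot (c : 'rV[R]_2) (p : R * V) : R :=
  cutoff_inv delta (gdet p) *
   ((c 0 0 * gram 1 1 p - c 0 1 * gram 0 1 p) * dot p.2 (grad 0 p) +
    (c 0 1 * gram 0 0 p - c 0 0 * gram 0 1 p) * dot p.2 (grad 1 p)).

Lemma dot_field c p : dot p.2 (field c p) =
  (1 - dot p.2 p.2 / r ^+ 2) ^+ 2 * field_dot c p.
Proof. by rewrite /field /field_dot dotZr dotDr !dotZr !dot_damp; ring. Qed.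

(** Equal to [1] at [c = 0], hence positive for small [c]. *)
Definition sphere_factor (c : 'rV[R]_2) (p : R * V) : R :=
  let s := stereo_ratio (field c p) in
  ((1 - s) ^+ 2 + 2 * (1 - s) * (dot p.2 p.2 - r ^+ 2) / r ^+ 4 * field_dot c p)
  / (1 + s) ^+ 2.

(** Whether a point lies inside, on or outside the sphere is unchanged by the
    displacement as long as [sphere_factor] is positive. *)
Lemma stereo_sphere c p : let z' := p.2 + stereo p.2 (field c p) in
  dot z' z' - r ^+ 2 = (dot p.2 p.2 - r ^+ 2) * sphere_factor c p.
Proof.
rewrite /sphere_factor /stereo /=.
have s1 := stereo_ratio1_neq0 (field c p); have rn0 : r != 0 by rewrite gt_eqF.
have sE : dot (field c p) (field c p) = 4 * r ^+ 2 * stereo_ratio (field c p).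
  by rewrite /stereo_ratio mulrC divfK// mulf_neq0// expf_neq0.
have := dot_field c p; move: (field c p) (field_dot c p) s1 sE => y fd s1 sE dy.
rewrite !dotE [dot y p.2]dotC dy sE.
by field; rewrite rn0 s1.
Qed.

Section SmoothFields.
Variables (U : normedModType R) (bU : basis U) (cc : U -> 'rV[R]_2) (pp : U -> R * V).
Hypotheses (sc : smooth cc) (sp : smooth pp).

Lemma smooth_radial_coef : smooth (fun x => radial_coef (pp x).2).
Proof.
apply: smoothM; last exact: smooth_cst.
apply: smoothB; first exact: smooth_cst.
by apply: smooth_dot; exact: smooth_fun2.
Qed.

Lemma smooth_damp k : smooth (fun x => damp (pp x).2 (grad k (pp x))).
Proof.
have s2 : smooth (fun x => (pp x).2) by exact: smooth_fun2.
have stereo_ratio' : smooth (fun x => grad k (pp x)).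
  by apply: (smooth_comp sp); exact: smooth_grad.
apply: smoothB => //; apply: smoothZ => //.
by apply: smoothM; [exact: smooth_radial_coef|exact: smooth_dot].
Qed.

Lemma smooth_gram i j : smooth (fun x => gram i j (pp x)).
Proof.
apply: smooth_dot; last exact: smooth_damp.
by apply: (smooth_comp sp); exact: smooth_grad.
Qed.

Lemma smooth_gdet : smooth (fun x => gdet (pp x)).
Proof.
have sgr := smooth_gram.
by apply: smoothB; [exact: smoothM|apply: smoothM].
Qed.

Lemma smooth_cut : smooth (fun x => cutoff_inv delta (gdet (pp x))).
Proof. by apply: (smooth_comp smooth_gdet) => k; exact: Ck_cutoff_inv. Qed.

Lemma smooth_coef (i j i' j' : 'I_2) (k l : 'I_2) :
  smooth (fun x => cc x 0 k * gram i j (pp x) - cc x 0 l * gram i' j' (pp x)).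
Proof.
by apply: smoothB; apply: smoothM; by [exact: smooth_entry|exact: smooth_gram].
Qed.

Lemma smooth_field : smooth (fun x => field (cc x) (pp x)).
Proof.
apply: smoothZ; first exact: smooth_cut.
by apply: smoothD; apply: smoothZ; by [exact: smooth_coef|exact: smooth_damp].
Qed.

Lemma smooth_field_dot : smooth (fun x => field_dot (cc x) (pp x)).
Proof.
have sgk k : smooth (fun x => dot (pp x).2 (grad k (pp x))).
  apply: smooth_dot; first exact: smooth_fun2.
  by apply: (smooth_comp sp); exact: smooth_grad.
apply: smoothM; first exact: smooth_cut.
by apply: smoothD; apply: smoothM => //; exact: smooth_coef.
Qed.

Lemma smooth_stereo_ratio : smooth (fun x => stereo_ratio (field (cc x) (pp x))).
Proof.
apply: smoothM; last exact: smooth_cst.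
by apply: smooth_dot; exact: smooth_field.
Qed.

Lemma smooth_stereo : smooth (fun x => stereo (pp x).2 (field (cc x) (pp x))).
Proof.
apply: smoothZ.
  apply: smoothV => [x|]; first exact: stereo_ratio1_neq0.
  by apply: smoothD; [exact: smooth_cst|exact: smooth_stereo_ratio].
apply: smoothB; first exact: smooth_field.
apply: smoothZ; last exact: smooth_fun2.
by apply: smoothM; [exact: smooth_cst|exact: smooth_stereo_ratio].
Qed.

Lemma smooth_sphere_factor : smooth (fun x => sphere_factor (cc x) (pp x)).
Proof.
have s1 : smooth (fun x => 1 - stereo_ratio (field (cc x) (pp x))).
  by apply: smoothB; [exact: smooth_cst|exact: smooth_stereo_ratio].
have s2 : smooth (fun x => 1 + stereo_ratio (field (cc x) (pp x))).
  by apply: smoothD; [exact: smooth_cst|exact: smooth_stereo_ratio].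
have s3 : smooth (fun x => dot (pp x).2 (pp x).2).
  by apply: smooth_dot; exact: smooth_fun2.
apply: smoothM; last first.
  apply: smoothV => [x|]; first by rewrite expf_neq0// stereo_ratio1_neq0.
  by apply: smoothM.
apply: smoothD; first exact: smoothM.
apply: smoothM; last exact: smooth_field_dot.
apply: smoothM; last exact: smooth_cst.
apply: smoothM; last by apply: smoothB => //; exact: smooth_cst.
by apply: smoothM => //; exact: smooth_cst.
Qed.

End SmoothFields.

End Fields.
(** * One small step of the isotopy *)

Section Neighbourhood.
Variables (R : realType) (N : nat) (r : R).
Hypothesis r0 : 0 < r.
Local Notation V := 'rV[R]_N.

Definition eball : set V := [set z | dot z z <= r ^+ 2].

Lemma smooth_sqnorm : smooth (fun z : V => dot z z).
Proof. by apply: smooth_dot; exact: smooth_id. Qed.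

Lemma open_smooth_gt0 (W : normedModType R) (f : W -> R) : smooth f ->
  open [set x | 0 < f x].
Proof.
move=> sf; apply: (@open_comp _ _ f [set y | 0 < y]) => [x _|].
  exact: smooth_continuous sf x.
exact: open_gt.
Qed.

Lemma compact_eball : compact eball.
Proof.
apply: bounded_closed_compact.
  exists r; split; first exact: num_real.
  move=> M rM z; rewrite /eball /= => zr; apply: le_trans (ltW rM).
  apply: rV_norm_le => [|j]; first exact: ltW.
  rewrite -ler_sqr ?nnegrE ?(ltW r0)// real_normK ?num_real//.
  apply: le_trans zr; rewrite /dot (bigD1 j)//= -expr2 lerDl.
  by apply: sumr_ge0 => i _; rewrite -expr2 sqr_ge0.
rewrite (_ : eball = (fun z : V => dot z z) @^-1` [set x | x <= r ^+ 2])//.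
apply: closed_comp => [z _|]; last exact: closed_le.
exact: smooth_continuous smooth_sqnorm z.
Qed.

Definition cylinder : set (R * V) := `[0, 1]%classic `*` eball.

Lemma compact_cylinder : compact cylinder.
Proof. by apply: compact_setX; [exact: segment_compact|exact: compact_eball]. Qed.

Definition diagonal : set (R * R * V) :=
  (fun p : R * V => ((p.1, p.1), p.2)) @` cylinder.

Lemma compact_diagonal : compact diagonal.
Proof.
apply: continuous_compact; last exact: compact_cylinder.
apply: continuous_subspaceT; apply: smooth_continuous.
apply: smooth_pair; last exact: smooth_snd.
by apply: smooth_pair; exact: smooth_fst.
Qed.

Definition near_diagonal (d : R) : set (R * R * V) :=
  [set q | [/\ 0 <= q.1.1 <= 1, 0 <= q.1.2 <= 1, `|q.1.1 - q.1.2| <= d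
             & eball q.2]].

(** A Lebesgue number for the compact diagonal. *)
Lemma near_diagonal_sub (O : set (R * R * V)) : open O -> diagonal `<=` O ->
  exists2 d : R, 0 < d & near_diagonal d `<=` O.
Proof.
move=> oO dO.
pose P (d : R) (p : R * V) := forall t : R, `|p.1 - t| <= d -> O ((p.1, t), p.2).
have H : \forall d \near (0 : R)^'+, cylinder `<=` P d.
  apply: ((compact_near_coveringP cylinder).1 compact_cylinder R (0^'+) P).
  move=> [s z] Csz.
  have Os : O ((s, s), z) by apply: dO; exists (s, z).
  have := open_nbhs_nbhs (conj oO Os).
  move=> [[A1 A2] /= [[[B1 B2] /= [nB1 nB2] HB] nA2] HA].
  have [e /= e0 He] := (nbhs_ballP _ _).1 nB2.
  exists ((B1 `&` ball s (e / 2)) `*` A2, [set d : R | d < e / 2]) => /=.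
    split; last by apply: nbhs_right_lt; exact: divr_gt0.
    exists (B1 `&` ball s (e / 2), A2) => //=; split=> //.
    by apply: filterI => //; apply: nbhsx_ballx; exact: divr_gt0.
  move=> [[s' z'] d] /= [[[Bs' bs'] Az'] de] t td.
  apply: (HA ((s', t), z')); split=> //=; apply: (HB (s', t)); split=> //=.
  apply: He; move: bs'; rewrite -!ball_normE /= => bs'.
  by have := ler_distD s' s t; lra.
have H0 : \forall d \near (0 : R)^'+, 0 < d by exact: nbhs_right_gt.
have H2 : \forall d \near (0:R)^'+, cylinder `<=` P d /\ 0 < d.
  exact: filterI H H0.
have H3 := @filter_ex _ (0 : R)^'+ _ _ H2.
have [d [Hd d0]] := H3; exists d => // -[[s t] z] [/= s01 t01 st zb].
by apply: (Hd (s, z)) => //; split=> //=; rewrite in_itv.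
Qed.

End Neighbourhood.

Section Step.
Variables (R : realType) (N : nat).
Local Notation V := 'rV[R]_N.
Local Notation C := 'rV[R]_2.
Local Notation Q := (R * R * V)%type.
Variables (F : R * V -> C) (r : R).
Hypotheses (sF : smooth F) (r0 : 0 < r).
Variable delta : R.
Hypothesis delta0 : 0 < delta.

Local Notation D := (gdet F r).
Local Notation ginv p := (cutoff_inv delta (D p)).

Let lo (x : Q * C) : R * V := (x.1.1.1, x.1.2).
Let disp (x : Q * C) : V := stereo r (lo x).2 (field F r delta x.2 (lo x)).
Let hi (x : Q * C) : R * V := (x.1.1.2, x.1.2 + disp x).

Let s_lo : smooth lo.
Proof.
have s1 : smooth (fun x : Q * C => x.1) by exact: smooth_fst.
apply: smooth_pair; last exact: smooth_fun2.
by apply: smooth_fun1; exact: smooth_fun1.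
Qed.

Let s_disp : smooth disp.
Proof. by apply: smooth_stereo => //; exact: smooth_snd. Qed.

Let s_hi : smooth hi.
Proof.
have s1 : smooth (fun x : Q * C => x.1) by exact: smooth_fst.
apply: smooth_pair.
  by apply: smooth_fun2; exact: smooth_fun1.
by apply: smoothD => //; exact: smooth_fun2.
Qed.

(** If [c = defect (q, c)], then [F] takes at the displaced point the value
    [F (s, z) + (D * ginv - 1) c], and [D * ginv = 1] where [delta <= D]. *)
Let defect (x : Q * C) : C :=
  F (lo x) - F (hi x) + (D (lo x) * ginv (lo x)) *: x.2.

Let s_defect : smooth defect.
Proof.
apply: smoothD.
  by apply: smoothB; [exact: (smooth_comp s_lo)|exact: (smooth_comp s_hi)].
apply: smoothZ; last exact: smooth_snd.
by apply: smoothM; [exact: smooth_gdet|exact: smooth_cut].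
Qed.

(** The second condition allows a lower bound on [D] to be carried back from
    the displaced point, which is needed for the inverse map. *)
Let Om : set (Q * C) := [set x | 0 < sphere_factor F r delta x.2 (lo x)] `&`
  [set x | 0 < delta ^+ 2 - (D (hi x) - D (lo x)) ^+ 2].

Let oOm : open Om.
Proof.
apply: openI; apply: open_smooth_gt0.
  by apply: smooth_sphere_factor => //; exact: smooth_snd.
have sd : smooth (fun x => D (hi x) - D (lo x)).
  by apply: smoothB; exact: smooth_gdet.
by apply: smoothB; [exact: smooth_cst|exact: smoothM].
Qed.

Let fieldZ (u : R) (c : C) p : field F r delta (u *: c) p = u *: field F r delta c p.
Proof.
apply: esym; rewrite /field !mxE scalerA mulrC -scalerA scalerDr; congr (_ *: _).
by rewrite !scalerA; congr (_ *: _ + _ *: _); ring.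
Qed.

Let field0 p : field F r delta 0 p = 0.
Proof. by rewrite -(scale0r 0) fieldZ scale0r. Qed.

Let stereo_ratio0 : stereo_ratio r (0 : V) = 0.
Proof. by rewrite /stereo_ratio -(scale0r 0) dotZl !mul0r. Qed.

Let disp0 q : disp (q, 0) = 0.
Proof. by rewrite /disp /stereo field0 stereo_ratio0 mulr0 scale0r subrr scaler0. Qed.

Let defect0 s z : defect (((s, s), z), 0) = 0.
Proof. by rewrite /defect /hi disp0 /lo /= addr0 subrr add0r scaler0. Qed.

Let Om0 s z : Om (((s, s), z), 0).
Proof.
split=> /=.
  rewrite /sphere_factor field0 stereo_ratio0 /field_dot !mxE !mul0r subrr !mul0r addr0.
  by rewrite !mulr0 !addr0 !subr0 expr1n divr1 ltr01.
by rewrite /hi disp0 /lo /= addr0 subrr expr0n subr0 exprn_gt0.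
Qed.

(** To first order in [c], the displacement is [field c p], on which the
    differential of [F] is the linear term of [defect]. *)
Let defect_diff s z (w : C) : 'D_((0 : Q, w)) defect (((s, s), z), 0) = 0.
Proof.
set p : R * V := (s, z); set y := field F r delta w p.
pose M (u : R) : R * V :=
  (0, (1 + u ^+ 2 * stereo_ratio r y)^-1 *: (y - (2 * (u * stereo_ratio r y)) *: z)).
pose curve (u : R) := p + u *: M u.
have uid : smooth (fun u : R => u) by exact: smooth_id.
have sM : smooth M.
  apply: smooth_pair; first exact: smooth_cst.
  apply: smoothZ.
    apply: smoothV => [u|].
      by rewrite gt_eqF// ltr_pwDl// mulr_ge0 ?sqr_ge0// stereo_ratio_ge0.
    apply: smoothD; first exact: smooth_cst.
    by apply: smoothM; [exact: smoothM|exact: smooth_cst].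
  apply: smoothB; first exact: smooth_cst.
  apply: smoothZ; last exact: smooth_cst.
  apply: smoothM; first exact: smooth_cst.
  by apply: smoothM => //; exact: smooth_cst.
have M0 : M 0 = (0, y).
  by rewrite /M expr0n !mul0r addr0 invr1 scale1r mulr0 scale0r subr0.
have Dcurve : is_derive (0 : R) 1 curve (0, y).
  have DM : is_derive (0 : R) 1 M ('D_1 M 0).
    by apply: derivableP; exact: (Ck_derive (sM 1)).
  have cM : {for (0 : R), continuous M} by exact: smooth_continuous.
  have D1 := is_deriveZf cM (is_derive_id (0 : R) 1) DM.
  apply: (is_derive_eq (is_deriveD (is_derive_cst p (0 : R) 1) D1)).
  by rewrite M0 scale0r addr0 scale1r add0r.
have curve0 : curve 0 = p by rewrite /curve scale0r addr0.
have dF : differentiable F (curve 0) by exact: smooth_differentiable.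
have DF := is_derive_comp Dcurve dF.
have dFy : 'd F (curve 0) (0, y) = (D p * ginv p) *: w.
  rewrite curve0 -deriveE; last exact: smooth_differentiable.
  by apply/rowP => k; rewrite -dot_grad// dot_grad_field// !mxE.
have line u : defect ((((s, s), z), 0) + u *: (0 : Q, w)) =
    F p - F (curve u) + (u * (D p * ginv p)) *: w.
  have -> : (((s, s), z), 0) + u *: (0 : Q, w) = (((s, s), z), u *: w).
    by congr pair; rewrite /= ?scaler0 ?addr0// add0r.
  rewrite /defect /hi /disp /lo /= fieldZ -/p -/y.
  congr (_ - F _ + _); last by rewrite scalerA mulrC.
  rewrite /curve; congr pair => /=; first by rewrite scaler0 addr0.
  congr (z + _); rewrite /stereo.
  have -> : stereo_ratio r (u *: y) = u ^+ 2 * stereo_ratio r y.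
    by rewrite /stereo_ratio dotZl dotZr expr2 !mulrA.
  have sw (x : R) (X : V) : u *: (x *: X) = x *: (u *: X) by rewrite !scalerA mulrC.
  rewrite [RHS]sw; congr (_ *: _).
  by rewrite scalerBr !scalerA; congr (_ - _ *: _); ring.
have [] : is_derive ((((s, s), z), 0) + 0 *: (0 : Q, w)) (0, w) defect 0; last first.
  by rewrite scale0r addr0.
apply/is_derive_line.
have -> : (fun u : R => defect ((((s, s), z), 0) + u *: (0 : Q, w))) =
    (fun u => F p - F (curve u) + (u * (D p * ginv p)) *: w).
  by apply: funext => u; exact: line.
have Dw : is_derive (0 : R) 1 (fun u : R => (u * (D p * ginv p)) *: w)
    ((D p * ginv p) *: w).
  have cw : {for (0 : R), continuous (fun=> (D p * ginv p) *: w)} by exact: cvg_cst.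
  have D1 := is_deriveZf cw (is_derive_id (0 : R) 1)
    (is_derive_cst ((D p * ginv p) *: w) (0 : R) 1).
  have -> : (fun u : R => (u * (D p * ginv p)) *: w) =
      (fun u : R => u *: ((D p * ginv p) *: w)).
    by apply: funext => u; rewrite scalerA.
  by apply: (is_derive_eq D1); rewrite scaler0 addr0 scale1r.
apply: (is_derive_eq (is_deriveD (is_deriveB (is_derive_cst (F p) (0 : R) 1) DF) Dw)).
by rewrite dFy sub0r addNr.
Qed.

(** The value of [F] is preserved forward where the determinant is at least
    [delta], and backward where it is at least [2 * delta]: the inverse map
    moves the determinant by less than [delta]. *)
Lemma step_maps : exists (d : R) (H K : Q -> V),
  [/\ 0 < d, smooth_map (near_diagonal r d) H, smooth_map (near_diagonal r d) K &
   forall s t z, near_diagonal r d ((s, t), z) ->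
   let h := H ((s, t), z) in let k := K ((s, t), z) in
   [/\ [/\ eball r h, (dot h h == r ^+ 2) = (dot z z == r ^+ 2),
          K ((s, t), h) = z & delta <= D (s, z) -> F (t, h) = F (s, z)] &
       [/\ eball r k, (dot k k == r ^+ 2) = (dot z z == r ^+ 2),
          H ((s, t), k) = z & 2 * delta <= D (t, z) -> F (s, k) = F (t, z)]]].
Proof.
have cd := @compact_diagonal R N r r0.
have [q [p _ <-]|q [p _ <-]|q w [p _ <-]|U1 [c [rho [oO1 dO1 rho0 Cc Hc]]]] :=
    fixed_point_near_compact oOm (fun k => smooth_Ck k Om s_defect) cd.
- exact: Om0.
- exact: defect0.
- exact: defect_diff.
pose A (q : Q) : V := disp (q, c q).
have CA k : Ck k U1 A.
  have Cq : Ck k U1 (fun q => (q, c q)) by apply: Ck_pair => //; exact: Ck_id.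
  by apply: (Ck_comp oO1 openT _ Cq (s_disp k)).
(* by uniqueness of the fixed point, also at points outside the ball *)
have A_diag s z : U1 ((s, s), z) -> A ((s, s), z) = 0.
  move=> /Hc [_ _ _ /(_ 0)]; rewrite normr0 => /(_ (ltW rho0)).
  by rewrite defect0 => /(_ erefl) c0; rewrite /A -c0 disp0.
(* the equation for the displacement of the inverse map *)
pose sh (x : Q * V) : Q := (x.1.1, x.1.2 + x.2).
have s_sh : smooth sh.
  have s1 : smooth (fun x : Q * V => x.1) by exact: smooth_fst.
  apply: smooth_pair; first exact: smooth_fun1.
  by apply: smoothD; [exact: smooth_fun2|exact: smooth_snd].
pose Om2 := sh @^-1` U1.
have oOm2 : open Om2.
  by apply: (@open_comp _ _ sh U1) => // x _; exact: smooth_continuous s_sh x.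
pose E2 (x : Q * V) : V := - A (sh x).
have CE2 k : Ck k Om2 E2.
  apply: CkN => //.
  by apply: (Ck_comp oOm2 oO1 _ _ (CA k)) => //; exact: smooth_Ck.
have dOm2 q : diagonal r q -> Om2 (q, 0).
  by move=> dq; rewrite /Om2 /sh /= addr0 -surjective_pairing; exact: dO1.
have E20 q : diagonal r q -> E2 (q, 0) = 0.
  move=> dq; have := dO1 _ dq; rewrite /E2 /sh /= addr0 -surjective_pairing.
  by case: dq => p _ <- Op; rewrite A_diag// oppr0.
have dE2 q w : diagonal r q -> 'D_((0, w)) E2 (q, 0) = 0.
  move=> dq; have Oq := dOm2 _ dq.
  have [] : is_derive ((q, 0 : V) + 0 *: (0 : Q, w)) (0, w) E2 0; last first.
    by rewrite scale0r addr0.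
  apply/is_derive_line.
  have c1 : {for (0 : R), continuous (fun u : R => (q, 0 : V) + u *: (0 : Q, w))}.
    apply: (@smooth_continuous R R _ (fun u : R => (q, 0 : V) + u *: (0 : Q, w))).
    apply: smoothD; first exact: smooth_cst.
    by apply: smoothZ; [exact: smooth_id|exact: smooth_cst].
  have En : \forall u \near (0 : R), 0 = E2 ((q, 0) + u *: (0 : Q, w)).
    have : \forall u \near (0 : R), Om2 ((q, 0) + u *: (0 : Q, w)).
      by apply: c1; rewrite scale0r addr0; exact: open_nbhs_nbhs.
    apply: filterS => u; case: dq => p _ <-.
    rewrite /Om2 /E2 /sh /= scaler0 !addr0 => /A_diag ->.
    by rewrite oppr0.
  apply: near_eq_is_derive En _; exact: is_derive_cst.
have [U2 [u [rho2 [oO2 dO2 rho20 Cu Hu]]]] :=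
  fixed_point_near_compact oOm2 CE2 cd dOm2 E20 dE2.
(* where [A] is smaller than the radius of uniqueness for the inverse *)
have [U3 [oO3 dO3 HO3]] : exists U3, [/\ open U3, diagonal r `<=` U3 &
    forall q, U3 q -> U1 q /\ `|A q| <= rho2].
  exists (interior [set q | U1 q /\ `|A q| <= rho2]); split.
  - exact: open_interior.
  - move=> q dq; have Oq := dO1 _ dq.
    apply: filterI; first exact: open_nbhs_nbhs.
    have cA : {for q, continuous A} by exact: Ck_continuous (CA 0%N) Oq.
    move/cvgrPdist_le : cA => /(_ rho2 rho20); apply: filterS => q' /=.
    by case: dq Oq => p _ <- Op; rewrite A_diag// sub0r normrN.
  - by move=> q /interior_subset.
have oO : open (U2 `&` U3) by exact: openI.
have dO : diagonal r `<=` U2 `&` U3 by move=> q dq; split; [exact: dO2|exact: dO3].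
have [d d0 Hd] := near_diagonal_sub r0 oO dO.
pose H (q : Q) := q.2 + A q.
pose K (q : Q) := q.2 + u q.
have C2 k (U : set Q) : Ck k U (fun q : Q => q.2).
  by apply: smooth_Ck; exact: smooth_snd.
have HF s t z : U1 ((s, t), z) -> 0 < sphere_factor F r delta (c ((s, t), z)) (s, z) /\
    dot (H ((s, t), z)) (H ((s, t), z)) - r ^+ 2 =
    (dot z z - r ^+ 2) * sphere_factor F r delta (c ((s, t), z)) (s, z).
  move=> Oz; have [_ [H1 _] _ _] := Hc _ Oz; split=> //.
  exact: (stereo_sphere F r0 delta (c ((s, t), z)) (s, z)).
have Hball s t z : U1 ((s, t), z) -> eball r (H ((s, t), z)) <-> eball r z.
  move=> /HF [H1 H2]; rewrite /eball /= -subr_le0 H2 pmulr_lle0// subr_le0.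
  by [].
have Hsph s t z : U1 ((s, t), z) ->
    (dot (H ((s, t), z)) (H ((s, t), z)) == r ^+ 2) = (dot z z == r ^+ 2).
  move=> /HF [H1 H2]; rewrite -subr_eq0 H2 mulf_eq0 (gt_eqF H1) orbF.
  by rewrite subr_eq0.
have HE s t z : U1 ((s, t), z) -> delta <= D (s, z) -> F (t, H ((s, t), z)) = F (s, z).
  move=> Oz dD; have [_ _ + _] := Hc _ Oz.
  rewrite /defect /lo /= cutoff_invE// scale1r => E.
  apply/eqP; rewrite eq_sym -subr_eq0; apply/eqP.
  by move: E; rewrite -{1}(add0r (c _)) => /addIr <-.
have KO1 s t w : U2 ((s, t), w) -> U1 ((s, t), K ((s, t), w)) /\ H ((s, t), K ((s, t), w)) = w.
  move=> /Hu [_ Oz uE _]; split=> //.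
  rewrite /H /K /=; move: uE; rewrite /E2 /sh /= => {1}->.
  by rewrite subrK.
exists d, H, K; split=> //.
- move=> q /Hd [_ Oq]; exists U3, H; split=> // k.
  apply: CkD => //; apply: (Ck_sub _ (CA k)) => q' /HO3 [] //.
- by move=> q /Hd [Oq _]; exists U2, K; split=> // k; apply: CkD.
move=> s t z nz h k.
have [_ _ st zb] := nz; have [_ z3] := Hd _ nz; have [z1 Az] := HO3 _ z3.
have hb : eball r h by apply/Hball.
have nh : near_diagonal r d ((s, t), h) by case: nz.
split; split=> //.
- exact: Hsph.
- have [h2 _] := Hd _ nh; have [_ _ _ /(_ (- A ((s, t), z)))] := Hu _ h2.
  rewrite normrN => /(_ Az); rewrite /E2 /sh /= {1 2}/h /H /= addrK => /(_ erefl) uE.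
  by rewrite /K /= -uE /h /H /= addrK.
- exact: HE.
- by have [z2 _] := Hd _ nz; have [k1 Hk] := KO1 _ _ _ z2; apply/(Hball s t k k1); rewrite Hk.
- by have [z2 _] := Hd _ nz; have [k1 Hk] := KO1 _ _ _ z2; rewrite -(Hsph s t k k1) Hk.
- by have [z2 _] := Hd _ nz; have [k1 Hk] := KO1 _ _ _ z2.
have [z2 _] := Hd _ nz; have [k1 Hk] := KO1 _ _ _ z2.
move=> dD; have Hkz : H ((s, t), k) = z by exact: Hk.
have E := HE s t k k1; rewrite Hkz in E; apply: esym; apply: E.
have [_ [_ Hlt] _ _] := Hc _ k1.
have {}Hlt : 0 < delta ^+ 2 - (D (t, H ((s, t), k)) - D (s, k)) ^+ 2 by exact: Hlt.
rewrite Hkz in Hlt.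
rewrite leNgt; apply/negP => Dk.
move: (D (t, z)) (D (s, k)) dD Hlt Dk => x y dD Hlt Dk.
have h1 : 0 < x - y - delta by lra.
have h2 : 0 < x - y + delta by have := delta0; lra.
have := mulr_gt0 h1 h2; rewrite -subr_sqr => h3.
by have := addr_gt0 Hlt h3; rewrite addrC subrKA subrr ltxx.
Qed.

End Step.
(** * Composing small steps *)

Section SmoothMaps.
Variable R : realType.
Implicit Types V W Z : normedModType R.

Lemma smooth_smooth_map V W (A : set V) (f : V -> W) : smooth f -> smooth_map A f.
Proof. by move=> sf x _; exists setT, f; split=> //; exact: openT. Qed.

Lemma smooth_map_comp V W Z {bW : basis W} {bZ : basis Z} (A : set V) (B : set W)
    (f : V -> W) (g : W -> Z) : (forall x, A x -> B (f x)) ->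
  smooth_map A f -> smooth_map B g -> smooth_map A (g \o f).
Proof.
move=> AB sf stereo_ratio x Ax.
have [U [f' [oU Ux Cf fE]]] := sf _ Ax.
have [U' [g' [oU' Ux' Cg gE]]] := stereo_ratio _ (AB _ Ax).
pose X := interior (U `&` f' @^-1` U').
have XU : X `<=` U by move=> y /interior_subset [].
have XU' y : X y -> U' (f' y) by move=> /interior_subset [].
exists X, (g' \o f'); split.
- exact: open_interior.
- apply: filterI; first exact: open_nbhs_nbhs.
  have cf : {for x, continuous f'} by exact: Ck_continuous (Cf 0%N) Ux.
  by apply: cf; apply: open_nbhs_nbhs; split=> //; rewrite fE.
- move=> k; apply: (Ck_comp _ oU' XU') => //; first exact: open_interior.
  exact: (Ck_sub XU).
- move=> y Ay Xy /=; rewrite fE//; last exact: XU.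
  by apply: gE; [exact: AB|rewrite -fE//; [exact: XU'|exact: XU]].
Qed.

Lemma smooth_map_pair V W Z {bW : basis W} {bZ : basis Z} (A : set V)
    (f : V -> W) (g : V -> Z) :
  smooth_map A f -> smooth_map A g -> smooth_map A (fun x => (f x, g x)).
Proof.
move=> sf stereo_ratio x Ax.
have [U [f' [oU Ux Cf fE]]] := sf _ Ax.
have [U' [g' [oU' Ux' Cg gE]]] := stereo_ratio _ Ax.
exists (U `&` U'), (fun x => (f' x, g' x)); split=> //.
- exact: openI.
- move=> k; apply: Ck_pair; first exact: openI.
    by apply: Ck_sub (Cf k) => y [].
  by apply: Ck_sub (Cg k) => y [].
- by move=> y Ay [Uy Uy']; rewrite fE// gE.
Qed.

End SmoothMaps.

Section Isotopy.
Variables (R : realType) (N : nat).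
Local Notation V := 'rV[R]_N.
Variables (F : R * V -> 'rV[R]_2) (r : R).
Hypotheses (sF : smooth F) (r0 : 0 < r).
Variables (T : bool -> 'rV[R]_2 -> Prop) (delta : R).

(** The condition [T] sees a point only through its value and through whether
    it lies on the sphere, which are the two data preserved by the steps. *)
Definition fiberwise (s : R) (z : V) :=
  eball r z /\ T (dot z z == r ^+ 2) (F (s, z)).

Hypothesis delta0 : 0 < delta.
Hypothesis regular : forall s z, 0 <= s <= 1 -> fiberwise s z ->
  2 * delta <= gdet F r (s, z).

Definition unit_ball : set (R * V) := [set q | 0 <= q.1 <= 1 /\ eball r q.2].

(** The value is to be preserved by [gi] as well, so that a level set is mapped
    onto the corresponding level set. *)
Definition transports (s t : R) (g gi : V -> V) := forall z, eball r z ->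
  [/\ [/\ eball r (g z), (dot (g z) (g z) == r ^+ 2) = (dot z z == r ^+ 2),
        gi (g z) = z & fiberwise s z -> F (t, g z) = F (s, z)] &
      [/\ eball r (gi z), (dot (gi z) (gi z) == r ^+ 2) = (dot z z == r ^+ 2),
        g (gi z) = z & fiberwise t z -> F (s, gi z) = F (t, z)]].

Lemma transports_comp s t u g gi h hi :
  transports s t g gi -> transports t u h hi ->
  transports s u (h \o g) (gi \o hi).
Proof.
move=> Hg Hh z zb; split=> /=.
  have [[gb gs gK gF] _] := Hg z zb; have [[hb hs hK hF] _] := Hh _ gb.
  split=> //; [by rewrite hs|by rewrite hK|].
  move=> fz; rewrite hF ?gF//; split=> //; rewrite gs gF//; exact: fz.2.
have [_ [hb hs hK hF]] := Hh z zb; have [_ [gb gs gK gF]] := Hg _ hb.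
split=> //; [by rewrite gs|by rewrite gK|].
move=> fz; rewrite gF ?hF//; split=> //; rewrite hs hF//; exact: fz.2.
Qed.

(** The isotopy from [0] to [t] is a composition of [m] small steps of length
    [t / m]; the number of steps does not depend on [t], hence the result is
    smooth in [t]. *)
Theorem isotopy_exists : exists G Gi : R -> V -> V,
  [/\ smooth_map unit_ball (fun q => G q.1 q.2),
      (forall t, 0 <= t <= 1 -> smooth_map (eball r) (Gi t)) &
      forall t, 0 <= t <= 1 -> transports 0 t (G t) (Gi t)].
Proof.
have [d [H [K [d0 sH sK HK]]]] := step_maps sF r0 delta0.
have step s t : 0 <= s <= 1 -> 0 <= t <= 1 -> `|s - t| <= d ->
    transports s t (fun z => H ((s, t), z)) (fun z => K ((s, t), z)).
  move=> s01 t01 st z zb; have nz : near_diagonal r d ((s, t), z) by [].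
  have [[h1 h2 h3 h4] [k1 k2 k3 k4]] := HK _ _ _ nz.
  split; split=> // fz.
    apply: h4; apply: le_trans (regular s01 fz).
    by rewrite mulr_natl mulr2n lerDl ltW.
  exact: k4 (regular t01 fz).
pose m := Num.bound d^-1.
have m0 : (0 : R) < m%:R.
  by apply: (lt_trans _ (archi_boundP _)); rewrite ?invr_gt0// invr_ge0 ltW.
have md : m%:R^-1 <= d.
  rewrite -[d]invrK lef_pV2 ?posrE ?invr_gt0//.
  by apply: ltW; apply: archi_boundP; rewrite invr_ge0 ltW.
pose sk (k : nat) (t : R) := t * (k%:R / m%:R).
have sk01 k t : (k <= m)%N -> 0 <= t <= 1 -> 0 <= sk k t <= 1.
  move=> km /andP[t0 t1]; rewrite /sk.
  have a0 : (0 : R) <= k%:R / m%:R by rewrite divr_ge0// ltW.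
  have a1 : k%:R / m%:R <= (1 : R) by rewrite ler_pdivrMr// mul1r ler_nat.
  by rewrite mulr_ge0//= mulr_ile1.
have skd k t : 0 <= t <= 1 -> `|sk k t - sk k.+1 t| <= d.
  move=> /andP[t0 t1]; apply: le_trans md.
  have -> : sk k t - sk k.+1 t = - (t * m%:R^-1).
    by rewrite /sk -natr1; field; rewrite gt_eqF.
  have im : (0 : R) <= m%:R^-1 by rewrite invr_ge0 ltW.
  by rewrite normrN ger0_norm ?mulr_ge0// ler_piMl.
suff main k : (k <= m)%N -> exists G Gi : R -> V -> V,
  [/\ smooth_map unit_ball (fun q => G q.1 q.2),
      (forall t, 0 <= t <= 1 -> smooth_map (eball r) (Gi t)) &
      forall t, 0 <= t <= 1 -> transports 0 (sk k t) (G t) (Gi t)].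
  have [G [Gi [sG sGi HG]]] := main m (leqnn _).
  exists G, Gi; split=> // t t01; have := HG t t01.
  by rewrite /sk divff ?gt_eqF// mulr1.
elim: k => [_|k IH km].
  exists (fun _ z => z), (fun _ z => z); split.
  - by apply: smooth_smooth_map; exact: smooth_snd.
  - by move=> t _; apply: smooth_smooth_map; exact: smooth_id.
  - by move=> t _ z zb; rewrite /sk mul0r mulr0.
have [G [Gi [sG sGi HG]]] := IH (ltnW km).
pose P t : R * R := (sk k t, sk k.+1 t).
exists (fun t z => H (P t, G t z)), (fun t z => Gi t (K (P t, z))).
have nP t z : 0 <= t <= 1 -> eball r z -> near_diagonal r d (P t, z).
  by move=> t01 zb; split=> //=; [exact/sk01/t01/ltnW|exact: sk01|exact: skd].
split.
- apply: (smooth_map_comp (B := near_diagonal r d) (f := fun q => (P q.1, G q.1 q.2))) => //.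
    by move=> [t z] [/= t01 zb]; apply: nP => //; have [[]] := HG t t01 z zb.
  apply: smooth_map_pair => //; apply: smooth_smooth_map.
  by apply: smooth_pair; apply: smoothM; by [exact: smooth_fst|exact: smooth_cst].
- move=> t t01.
  apply: (smooth_map_comp (B := eball r) (f := fun z => K (P t, z))); last exact: sGi.
    move=> z zb; have [_ []] := step _ _ (sk01 _ _ (ltnW km) t01) (sk01 _ _ km t01) (skd _ _ t01) z zb.
    by [].
  apply: (smooth_map_comp (B := near_diagonal r d) (f := fun z => (P t, z))) => //.
    by move=> z; exact: nP.
  by apply: smooth_smooth_map; apply: smooth_pair; [exact: smooth_cst|exact: smooth_id].
- move=> t t01.
  have := step _ _ (sk01 _ _ (ltnW km) t01) (sk01 _ _ km t01) (skd k _ t01).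
  exact: transports_comp (HG t t01).
Qed.

End Isotopy.
(** * Complex-valued functions *)

Section ComplexValued.
Variable R : realType.
Local Notation re := (@complex.Re R).
Local Notation im := (@complex.Im R).

Lemma re_mul (x y : R[i]) : re (x * y) = re x * re y - im x * im y.
Proof. by case: x y => [? ?] [? ?]. Qed.

Lemma im_mul (x y : R[i]) : im (x * y) = re x * im y + im x * re y.
Proof. by case: x y => [? ?] [? ?]. Qed.

Lemma re_add (x y : R[i]) : re (x + y) = re x + re y.
Proof. by case: x y => [? ?] [? ?]. Qed.

Lemma im_add (x y : R[i]) : im (x + y) = im x + im y.
Proof. by case: x y => [? ?] [? ?]. Qed.

Lemma re_conj (x : R[i]) : re (x^*)%C = re x.
Proof. by case: x. Qed.

Lemma im_conj (x : R[i]) : im (x^*)%C = - im x.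
Proof. by case: x. Qed.

Section CSmooth.
Variable V : normedModType R.
Implicit Types f g : V -> R[i].

Definition csmooth f := smooth (fun x => re (f x)) /\ smooth (fun x => im (f x)).

Lemma csmooth_cst (c : R[i]) : csmooth (fun=> c).
Proof. by split; exact: smooth_cst. Qed.

Lemma csmoothD f g : csmooth f -> csmooth g -> csmooth (fun x => f x + g x).
Proof.
move=> [f1 f2] [g1 g2]; split.
  under [X in smooth X]funext do rewrite re_add; exact: smoothD.
under [X in smooth X]funext do rewrite im_add; exact: smoothD.
Qed.

Lemma csmoothM f g : csmooth f -> csmooth g -> csmooth (fun x => f x * g x).
Proof.
move=> [f1 f2] [g1 g2]; split.
  under [X in smooth X]funext do rewrite re_mul.
  by apply: smoothB; exact: smoothM.
under [X in smooth X]funext do rewrite im_mul.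
by apply: smoothD; exact: smoothM.
Qed.

Lemma csmoothX f n : csmooth f -> csmooth (fun x => f x ^+ n).
Proof.
move=> sf; elim: n => [|n IH]; first exact: csmooth_cst.
under [X in csmooth X]funext do rewrite exprS; exact: csmoothM.
Qed.

Lemma csmooth_conj f : csmooth f -> csmooth (fun x => (f x)^*)%C.
Proof.
move=> [f1 f2]; split.
  by under [X in smooth X]funext do rewrite re_conj.
by under [X in smooth X]funext do rewrite im_conj; exact: smoothN.
Qed.

Lemma csmooth_sum n (f : 'I_n -> V -> R[i]) :
  (forall j, csmooth (f j)) -> csmooth (fun x => \sum_(j < n) f j x).
Proof.
move=> sf; elim: n f sf => [|n IH] f sf.
  by under [X in csmooth X]funext do rewrite big_ord0; exact: csmooth_cst.
under [X in csmooth X]funext do rewrite big_ord_recl; apply: csmoothD => //.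
exact: IH.
Qed.

End CSmooth.

Definition has_cderiv (f : R -> R[i]) (d : R[i]) :=
  is_derive (0 : R) 1 (fun u => re (f u)) (re d) /\
  is_derive (0 : R) 1 (fun u => im (f u)) (im d).

Lemma has_cderiv_eq f d d' : has_cderiv f d -> d = d' -> has_cderiv f d'.
Proof. by move=> ? <-. Qed.

Lemma has_cderiv_cst c : has_cderiv (fun=> c) 0.
Proof. by split; exact: is_derive_cst. Qed.

Lemma has_cderivD f g d e :
  has_cderiv f d -> has_cderiv g e -> has_cderiv (fun u => f u + g u) (d + e).
Proof.
move=> [f1 f2] [g1 g2]; split.
  under [X in is_derive _ _ X]funext do rewrite re_add.
  by rewrite re_add; exact: is_deriveD.
under [X in is_derive _ _ X]funext do rewrite im_add.
by rewrite im_add; exact: is_deriveD.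
Qed.

Lemma has_cderivM f g d e :
  has_cderiv f d -> has_cderiv g e ->
  has_cderiv (fun u => f u * g u) (d * g 0 + f 0 * e).
Proof.
move=> [f1 f2] [g1 g2]; split.
  under [X in is_derive _ _ X]funext do rewrite re_mul.
  apply: (is_derive_eq (is_deriveB (is_deriveM f1 g1) (is_deriveM f2 g2))).
  rewrite re_add !re_mul -![_ *: _]/(_ * _); ring.
under [X in is_derive _ _ X]funext do rewrite im_mul.
apply: (is_derive_eq (is_deriveD (is_deriveM f1 g2) (is_deriveM f2 g1))).
rewrite im_add !im_mul -![_ *: _]/(_ * _); ring.
Qed.

(** Logarithmic derivatives add up along products, also where the factors
    vanish; monomials are differentiated this way. *)
Definition log_deriv f c := has_cderiv f (c * f 0).

Lemma log_derivM f g c c' : log_deriv f c -> log_deriv g c' ->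
  log_deriv (fun u => f u * g u) (c + c').
Proof. by move=> H1 H2; apply: (has_cderiv_eq (has_cderivM H1 H2)); ring. Qed.

Lemma log_deriv_cst c : log_deriv (fun=> c) 0.
Proof. by rewrite /log_deriv mul0r; exact: has_cderiv_cst. Qed.

Lemma log_derivX f c n : log_deriv f c -> log_deriv (fun u => f u ^+ n) (n%:R * c).
Proof.
move=> Hf; elim: n => [|n IH]; first by rewrite mul0r; exact: log_deriv_cst.
under [X in log_deriv X]funext do rewrite exprS.
by rewrite -natr1 mulrDl mul1r addrC; exact: log_derivM.
Qed.

Lemma log_deriv_conj f c : log_deriv f c -> log_deriv (fun u => (f u)^*)%C (c^*)%C.
Proof.
move=> [f1 f2]; rewrite /log_deriv -rmorphM/=; split.
  by rewrite re_conj; under [X in is_derive _ _ X]funext do rewrite re_conj.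
rewrite im_conj; under [X in is_derive _ _ X]funext do rewrite im_conj.
exact: is_deriveN.
Qed.

Lemma has_cderiv_sum n (f : 'I_n -> R -> R[i]) d :
  (forall j, has_cderiv (f j) (d j)) ->
  has_cderiv (fun u => \sum_(j < n) f j u) (\sum_(j < n) d j).
Proof.
elim: n f d => [|n IH] f d H.
  by rewrite big_ord0; under [X in has_cderiv X]funext do rewrite big_ord0;
    exact: has_cderiv_cst.
rewrite big_ord_recl; under [X in has_cderiv X]funext do rewrite big_ord_recl.
by apply: has_cderivD => //; exact: IH.
Qed.

Lemma log_deriv_line (z c : R[i]) : log_deriv (fun u => z + u%:C * (c * z)) c.
Proof.
have Du (m : R) : is_derive (0 : R) 1 (fun u : R => u * m) m.
  apply: (is_derive_eq (is_deriveM (is_derive_id (0 : R) 1) (is_derive_cst m (0 : R) 1))).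
  by rewrite scaler0 add0r [_ *: _]mulr1.
rewrite /log_deriv mul0r addr0; split.
  under [X in is_derive _ _ X]funext do rewrite re_add re_mul /= mul0r subr0.
  apply: (is_derive_eq (is_deriveD (is_derive_cst (re z) (0 : R) 1) (Du _))).
  by rewrite add0r.
under [X in is_derive _ _ X]funext do rewrite im_add im_mul /= mul0r addr0.
apply: (is_derive_eq (is_deriveD (is_derive_cst (im z) (0 : R) 1) (Du _))).
by rewrite add0r.
Qed.

End ComplexValued.
(** * Nonzero values of the family are regular *)

Section MixedPolynomial.
Variables (R : realType) (n : nat) (a b : 'I_n -> nat).
Local Notation C := R[i].

(** Every monomial is an eigenvector of the derivation along the diagonal field
    [gam j * z_j]; the condition [gam n = 0] matches the convention
    [z_(n+1) = 1] of [next_coord]. *)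
Lemma f_It_diagonal_deriv (t : R) (z : 'rV[C]_n) (gam : nat -> C) : gam n = 0 ->
  has_cderiv (fun u : R => f_It a b t (\row_j (z 0 j + u%:C * (gam j * z 0 j))))
   ((1 - t%:C) * (\sum_(j < n) ((a j + b j)%:R * gam j + (b j)%:R * (gam j)^*%C + gam j.+1)
       * (z 0 j ^+ (a j + b j) * (z 0 j)^*%C ^+ b j * next_coord z j)) +
    t%:C * (\sum_(j < n) ((a j)%:R * gam j + gam j.+1) * (z 0 j ^+ a j * next_coord z j))).
Proof.
move=> gn; pose Z (u : R) := \row_j (z 0 j + u%:C * (gam j * z 0 j)).
have Z0 : Z 0 = z by apply/rowP => j; rewrite mxE mul0r addr0.
have lz j : log_deriv (fun u => Z u 0 j) (gam j).
  by under [X in log_deriv X]funext do rewrite mxE; exact: log_deriv_line.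
have ln (j : 'I_n) : log_deriv (fun u => next_coord (Z u) j) (gam j.+1).
  rewrite /next_coord; case: insubP => [k _ <-|]; first exact: lz.
  rewrite -leqNgt => nj; have -> : j.+1 = n by apply/eqP; rewrite eqn_leq nj ltn_ord.
  by rewrite gn; exact: log_deriv_cst.
have cm c f d : has_cderiv f d -> has_cderiv (fun u : R => c * f u) (c * d).
  move=> H; apply: (has_cderiv_eq (has_cderivM (has_cderiv_cst c) H)).
  by rewrite mul0r add0r.
apply: has_cderivD; apply: cm; apply: has_cderiv_sum => j.
  have H := log_derivM (log_derivM (log_derivX (a j + b j) (lz j))
    (log_derivX (b j) (log_deriv_conj (lz j)))) (ln j).
  by move: H; rewrite /log_deriv Z0.
have H := log_derivM (log_derivX (a j) (lz j)) (ln j).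
by move: H; rewrite /log_deriv Z0.
Qed.

(** Where [tau j] vanishes the equation reads [0 = 0], and any value of [c j],
    such as the one given by division by zero, will do. *)
Lemma downward_recursion (rho tau : nat -> R) :
  (forall j, tau j = 0 -> rho j = 0) ->
  exists c : nat -> R, c n = 0 /\
    forall j, (j < n)%N -> c j * tau j = (1 - c j.+1) * rho j.
Proof.
move=> tr; pose d := fix d k := if k is k'.+1 then
  (1 - d k') * rho (n - k'.+1)%N / tau (n - k'.+1)%N else 0.
exists (fun j => d (n - j)%N); split; first by rewrite subnn.
move=> j jn; have E : (n - j = (n - j.+1).+1)%N by rewrite subnSK.
rewrite E /= -/d -E subKn ?(ltnW jn)//.
have [t0|t0] := eqVneq (tau j) 0; first by rewrite t0 tr// !mulr0.
by rewrite divfK.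
Qed.

Hypothesis ha : forall j, (1 <= a j)%N.

(** Weights with [a_j c_j + c_(j+1) = 1] turn every monomial by the same angle,
    those of [f_I] as well as those of [g_I]. *)
Lemma angular_field (t : R) (z : 'rV[C]_n) : exists gam : nat -> C,
  has_cderiv (fun u : R => f_It a b t (\row_j (z 0 j + u%:C * (gam j * z 0 j))))
    ('i%C * f_It a b t z).
Proof.
pose rho (_ : nat) : R := 1.
pose tau (j : nat) : R := if insub j is Some k then (a k)%:R else 1.
have [j|c [cn cj]] := downward_recursion (rho := rho) (tau := tau).
  rewrite /tau; case: insubP => [k _ _|_] /eqP; last by rewrite oner_eq0.
  by rewrite pnatr_eq0 => /eqP k0; have := ha k; rewrite k0.
have c1 (j : 'I_n) : (a j)%:R * (c j)%:C + (c j.+1)%:C = 1.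
  have := cj j (ltn_ord j); rewrite /tau valK /rho mulr1 => E.
  rewrite -(rmorph_nat (real_complex R)) -rmorphM -rmorphD/= mulrC E subrK.
  by rewrite rmorph1.
pose gam (j : nat) : C := 'i%C * (c j)%:C.
have gn : gam n = 0 by rewrite /gam cn mulr0.
exists gam; apply: (has_cderiv_eq (f_It_diagonal_deriv t z gn)).
have icJ (x : R) : (('i * x%:C)^*)%C = - ('i%C * x%:C).
  by apply/eqP; rewrite eq_complex /=; apply/andP; split; apply/eqP; ring.
have cE (j : 'I_n) (x : C) :
    (a j)%:R * ('i%C * (c j)%:C) * x + 'i%C * (c j.+1)%:C * x = 'i%C * x.
  transitivity ('i%C * ((a j)%:R * (c j)%:C + (c j.+1)%:C) * x); first by ring.
  by rewrite c1 mulr1.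
rewrite /f_It /f_I /g_I mulrDr ![in RHS](mulrCA 'i%C); congr (_ * _ + _ * _).
  rewrite mulr_sumr; apply: eq_bigr => j _.
  by rewrite -(cE j) /gam icJ natrD; ring.
by rewrite mulr_sumr; apply: eq_bigr => j _; rewrite -(cE j) /gam; ring.
Qed.

(** The terms of [f_I] and [g_I] with index [j] differ by the factor
    [nb j = |z_j|^(2 b_j)] only, so one weight [c_j] suits their combination;
    it depends on [z]. *)
Lemma radial_field (t : R) (z : 'rV[C]_n) : 0 <= t <= 1 -> exists gam : nat -> C,
  has_cderiv (fun u : R => f_It a b t (\row_j (z 0 j + u%:C * (gam j * z 0 j))))
    (f_It a b t z).
Proof.
move=> /andP[t0 t1].
pose nb (k : 'I_n) : R := (complex.Re (z 0 k) ^+ 2 + complex.Im (z 0 k) ^+ 2) ^+ b k.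
have nb0 k : 0 <= nb k by rewrite exprn_ge0// addr_ge0// sqr_ge0.
pose rho (j : nat) : R := if insub j is Some k then (1 - t) * nb k + t else 1.
pose tau (j : nat) : R := if insub j is Some k then
  (1 - t) * nb k * (a k + 2 * b k)%:R + t * (a k)%:R else 1.
have [j|c [cn cj]] := downward_recursion (rho := rho) (tau := tau).
  rewrite /tau /rho; case: insubP => [k _ _|_] /eqP; last by rewrite oner_eq0.
  have p1 : 0 <= (1 - t) * nb k by rewrite mulr_ge0// subr_ge0.
  have ak : (1 : R) <= (a k)%:R by rewrite ler1n.
  have ak2 : (1 : R) <= (a k + 2 * b k)%:R by rewrite ler1n addn_gt0 ha.
  by move=> /eqP H; nra.
have zz (k : 'I_n) : z 0 k * (z 0 k)^*%C =
    (complex.Re (z 0 k) ^+ 2 + complex.Im (z 0 k) ^+ 2)%:C.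
  by rewrite -sqr_normc add_Re2_Im2.
have zE (k : 'I_n) : z 0 k ^+ (a k + b k) * (z 0 k)^*%C ^+ b k = (nb k)%:C * z 0 k ^+ a k.
  by rewrite exprD -mulrA -exprMn zz /nb rmorphXn/= mulrC.
have c1 (j : 'I_n) : (1 - t%:C) * (nb j)%:C * (((a j)%:R + 2 * (b j)%:R) * (c j)%:C + (c j.+1)%:C)
   + t%:C * ((a j)%:R * (c j)%:C + (c j.+1)%:C) = (1 - t%:C) * (nb j)%:C + t%:C.
  have := cj j (ltn_ord j); rewrite /tau /rho valK => E.
  have {}E : (1 - t) * nb j * (((a j)%:R + 2 * (b j)%:R) * c j + c j.+1)
     + t * ((a j)%:R * c j + c j.+1) = (1 - t) * nb j + t.
    by move: E; rewrite natrD natrM => E; lra.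
  have := congr1 (real_complex R) E.
  by rewrite !(rmorphD, rmorphM, rmorphN, rmorph1, rmorph_nat).
pose gam (j : nat) : C := (c j)%:C.
have gn : gam n = 0 by rewrite /gam cn.
exists gam; apply: (has_cderiv_eq (f_It_diagonal_deriv t z gn)).
rewrite /f_It /f_I /g_I !mulr_sumr -!big_split; apply: eq_bigr => j _.
rewrite /gam conjc_real /= zE natrD.
transitivity (((1 - t%:C) * (nb j)%:C + t%:C) * (z 0 j ^+ a j * next_coord z j)); last by ring.
rewrite -(c1 j); ring.
Qed.

End MixedPolynomial.
(** * Positivity of the Gram determinant *)

Section GramPositive.
Variables (R : realType) (N : nat) (F : R * 'rV[R]_N -> 'rV[R]_2) (r : R).
Hypothesis r0 : 0 < r.

Lemma dot_gt0 (x w : 'rV[R]_N) : dot x w != 0 -> 0 < dot x x.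
Proof.
move=> xw; rewrite lt_def dot_ge0 andbT; apply: contra xw => /eqP /dot_eq0 ->.
by rewrite -(scale0r 0) dotZl mul0r.
Qed.

(** The quadratic form of [damp] is the squared norm of the tangential
    component on the sphere; inside it is positive definite, by the
    Cauchy-Schwarz inequality. *)
Lemma damp_gt0 (z g w : 'rV[R]_N) : dot z z <= r ^+ 2 ->
  (dot z z = r ^+ 2 -> dot z w = 0) -> dot g w != 0 -> 0 < dot g (damp r z g).
Proof.
move=> zr zw gw; have rn0 : r != 0 by rewrite gt_eqF.
have gg := dot_gt0 gw.
have -> : dot g (damp r z g) = dot g g - (2 * r ^+ 2 - dot z z) / r ^+ 4 * dot z g ^+ 2.
  by rewrite /damp /radial_coef !dotE [dot g z]dotC; ring.
have [zE|zlt] := eqVneq (dot z z) (r ^+ 2).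
  pose x := g - (dot z g / r ^+ 2) *: z.
  have xw : dot x w != 0 by rewrite /x !dotE (zw zE) mulr0 oppr0 addr0.
  have := dot_gt0 xw; congr (0 < _).
  by rewrite /x !dotE [dot g z]dotC zE; field.
have {zlt}zr' : dot z z < r ^+ 2 by rewrite lt_def eq_sym zlt.
have CS : dot z g ^+ 2 <= dot z z * dot g g.
  have := dot_ge0 (dot g g *: z - dot z g *: g).
  have -> : dot (dot g g *: z - dot z g *: g) (dot g g *: z - dot z g *: g) =
      dot g g * (dot z z * dot g g - dot z g ^+ 2).
    by rewrite !dotE [dot g z]dotC; ring.
  by rewrite pmulr_rge0// subr_ge0.
have k0 : 0 <= (2 * r ^+ 2 - dot z z) / r ^+ 4.
  by rewrite divr_ge0 ?exprn_ge0 ?(ltW r0)//; have := sqr_ge0 r; lra.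
apply: (@lt_le_trans _ _ (dot g g * (1 - dot z z / r ^+ 2) ^+ 2)).
  by rewrite mulr_gt0// exprn_gt0// subr_gt0 ltr_pdivrMr ?mul1r// exprn_gt0.
have := ler_wpM2l k0 CS.
have -> : dot g g * (1 - dot z z / r ^+ 2) ^+ 2 = dot g g -
   (2 * r ^+ 2 - dot z z) / r ^+ 4 * (dot z z * dot g g) by field.
by rewrite lerD2l lerN2.
Qed.

(** The Gram matrix is positive definite because a combination [al, be] of the
    two gradients is tested against a vector on which they take the values
    [al] and [be]. *)
Lemma gdet_gt0 (p : R * 'rV[R]_N) : dot p.2 p.2 <= r ^+ 2 ->
  (forall y0 y1 : R, exists w, [/\ dot (grad F 0 p) w = y0, dot (grad F 1 p) w = y1 &
     dot p.2 p.2 = r ^+ 2 -> dot p.2 w = 0]) -> 0 < gdet F r p.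
Proof.
move=> pr Hy.
have Q (al be : R) : (al != 0) || (be != 0) ->
    0 < al ^+ 2 * gram F r 0 0 p + 2 * al * be * gram F r 0 1 p + be ^+ 2 * gram F r 1 1 p.
  move=> ab; have [w [w0 w1 wz]] := Hy al be.
  pose g := al *: grad F 0 p + be *: grad F 1 p.
  have -> : al ^+ 2 * gram F r 0 0 p + 2 * al * be * gram F r 0 1 p + be ^+ 2 * gram F r 1 1 p
      = dot g (damp r p.2 g).
    rewrite /gram /g /damp !dotE [dot p.2 (grad F 0 p)]dotC [dot p.2 (grad F 1 p)]dotC.
    by rewrite [dot (grad F 1 p) (grad F 0 p)]dotC; ring.
  apply: (damp_gt0 pr wz); rewrite /g !dotE w0 w1 -!expr2.
  by rewrite paddr_eq0 ?sqr_ge0// !sqrf_eq0 negb_and.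
have A11 : 0 < gram F r 1 1 p.
  by have := Q 0 1; rewrite oner_eq0 orbT => /(_ isT); rewrite expr0n/= !(mulr0, mul0r, add0r, expr1n, mul1r).
have := Q (gram F r 1 1 p) (- gram F r 0 1 p); rewrite gt_eqF// => /(_ isT).
rewrite /gdet; move: (gram _ _ _ _ _) (gram F r 0 1 p) (gram F r 1 1 p) A11 => x y z z0 H.
have {}H : 0 < z * (x * z - y ^+ 2) by move: H; congr (0 < _); ring.
by rewrite pmulr_rgt0 in H.
Qed.

End GramPositive.

(** * Real coordinates on C^n *)

Section FinalSetup.
Variables (R : realType) (n : nat) (a b : 'I_n -> nat).
Local Notation C := R[i].
Local Notation V := 'rV[R]_(n + n).
Local Notation P := ('rV[R]_n * 'rV[R]_n)%type.

Definition real_row (p : P) : V := row_mx p.1 p.2.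
Definition real_pair (v : V) : P := (lsubmx v, rsubmx v).

Lemma real_rowK : cancel real_row real_pair.
Proof. by case=> x y; rewrite /real_pair /real_row row_mxKl row_mxKr. Qed.

Lemma real_pairK : cancel real_pair real_row.
Proof. by move=> v; rewrite /real_row hsubmxK. Qed.

Lemma smooth_real_row : smooth real_row.
Proof.
apply: smooth_row => j; have E (p : P) : real_row p 0 j =
    match fintype.split j with inl k => p.1 0 k | inr k => p.2 0 k end.
  by rewrite mxE.
under [X in smooth X]funext do rewrite E.
by case: (fintype.split j) => k; apply: smooth_entry; [exact: smooth_fst|exact: smooth_snd].
Qed.

Lemma smooth_real_pair : smooth real_pair.
Proof.
apply: smooth_pair; apply: smooth_row => j.
  have E (v : V) : lsubmx v 0 j = v 0 (lshift n j) by rewrite mxE.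
  by under [X in smooth X]funext do rewrite E; apply: smooth_entry; exact: smooth_id.
have E (v : V) : rsubmx v 0 j = v 0 (rshift n j) by rewrite mxE.
by under [X in smooth X]funext do rewrite E; apply: smooth_entry; exact: smooth_id.
Qed.

Lemma real_row_line p w (u : R) : real_row (p + u *: w) = real_row p + u *: real_row w.
Proof. by rewrite /real_row scale_row_mx add_row_mx. Qed.

Lemma realifyK : cancel (@realify R n) (@complexify R n).
Proof. by move=> z; apply/rowP => j; rewrite !mxE; case: (z 0 j). Qed.

Lemma complexifyK : cancel (@complexify R n) (@realify R n).
Proof. by case=> x y; congr pair; apply/rowP => j; rewrite !mxE. Qed.

Definition to_real (z : 'rV[C]_n) : V := real_row (realify z).
Definition to_complex (v : V) : 'rV[C]_n := complexify (real_pair v).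

Lemma to_realK : cancel to_real to_complex.
Proof. by move=> z; rewrite /to_complex real_rowK realifyK. Qed.

Lemma to_complexK : cancel to_complex to_real.
Proof. by move=> v; rewrite /to_real complexifyK real_pairK. Qed.

Lemma to_complexE v j : to_complex v 0 j = v 0 (lshift n j) +i* v 0 (rshift n j).
Proof. by rewrite !mxE. Qed.

Lemma to_complex_line (v w : V) (u : R) j :
  to_complex (v + u *: w) 0 j = to_complex v 0 j + u%:C * to_complex w 0 j.
Proof.
rewrite !to_complexE ![in LHS]mxE.
by apply/eqP; rewrite eq_complex /=; apply/andP; split; apply/eqP; ring.
Qed.

Lemma to_realD z w : to_real (z + w) = to_real z + to_real w.
Proof.
rewrite /to_real /real_row add_row_mx; congr row_mx; apply/rowP => j; rewrite !mxE.
  by rewrite re_add.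
by rewrite im_add.
Qed.

Lemma dot_to_real z w : dot (to_real z) (to_real w) = real_dot z w.
Proof.
rewrite /dot big_split_ord/= /real_dot -big_split/=; apply: eq_bigr => j _.
rewrite !row_mxEl !row_mxEr !mxE.
by case: (z 0 j) (w 0 j) => [x y] [x' y'] /=; ring.
Qed.

Lemma real_dot_ge0 (z : 'rV[C]_n) : 0 <= real_dot z z.
Proof. by rewrite -dot_to_real dot_ge0. Qed.

Lemma sphereE (r : R) (z : 'rV[C]_n) : 0 < r ->
  sphere r z <-> dot (to_real z) (to_real z) = r ^+ 2.
Proof.
move=> r0; rewrite dot_to_real /sphere /= /enorm; split=> [<-|->].
  by rewrite sqr_sqrtr// real_dot_ge0.
by rewrite sqrtr_sqr ger0_norm// ltW.
Qed.

Lemma enorm_le (r : R) (z : 'rV[C]_n) : 0 < r ->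
  (enorm z <= r) = (dot (to_real z) (to_real z) <= r ^+ 2).
Proof.
move=> r0; rewrite dot_to_real /enorm -[in LHS](ger0_norm (ltW r0)) -sqrtr_sqr.
by rewrite ler_sqrt ?sqr_ge0.
Qed.

Definition fmap (q : R * V) : 'rV[R]_2 :=
  \row_(k < 2) (if k == 0 then complex.Re (f_It a b q.1 (to_complex q.2))
                else complex.Im (f_It a b q.1 (to_complex q.2))).

Definition sqmod (y : 'rV[R]_2) : R := y 0 0 ^+ 2 + y 0 1 ^+ 2.

Lemma fmap_eq t z t' z' : fmap (t, to_real z) = fmap (t', to_real z') ->
  f_It a b t z = f_It a b t' z'.
Proof.
move=> E; have := congr1 (fun y : 'rV[R]_2 => y 0 0) E.
have := congr1 (fun y : 'rV[R]_2 => y 0 1) E; rewrite !mxE /= !to_realK.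
by move=> h1 h0; apply/eqP; rewrite eq_complex h0 h1 !eqxx.
Qed.

Lemma sqmod_fmap t z : `|f_It a b t z| = (Num.sqrt (sqmod (fmap (t, to_real z))))%:C.
Proof. by rewrite normc_def /sqmod !mxE /= to_realK. Qed.

Lemma sqmod_ge0 y : 0 <= sqmod y.
Proof. by rewrite addr_ge0// sqr_ge0. Qed.

Lemma norm_le t z (e : R) : 0 < e ->
  (`|f_It a b t z| <= e%:C) = (sqmod (fmap (t, to_real z)) <= e ^+ 2).
Proof.
move=> e0; rewrite sqmod_fmap lecR -[in LHS](ger0_norm (ltW e0)) -sqrtr_sqr.
by rewrite ler_sqrt ?sqr_ge0.
Qed.

Lemma norm_eq t z (e : R) : 0 < e ->
  `|f_It a b t z| = e%:C <-> sqmod (fmap (t, to_real z)) = e ^+ 2.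
Proof.
move=> e0; rewrite sqmod_fmap; split=> [/complexI <-|->].
  by rewrite sqr_sqrtr// sqmod_ge0.
by rewrite sqrtr_sqr ger0_norm// ltW.
Qed.

Lemma csmooth_f_It : csmooth (fun q : R * V => f_It a b q.1 (to_complex q.2)).
Proof.
have sz j : csmooth (fun q : R * V => to_complex q.2 0 j).
  by split; under [X in smooth X]funext do rewrite to_complexE /=;
    apply: smooth_entry; exact: smooth_snd.
have sn j : csmooth (fun q : R * V => next_coord (to_complex q.2) j).
  rewrite /next_coord; case: insub => [k|]; [exact: sz|exact: csmooth_cst].
have st : csmooth (fun q : R * V => q.1%:C).
  by split; [exact: smooth_fst|exact: smooth_cst].
have s1t : csmooth (fun q : R * V => 1 - q.1%:C).
  have E (x : R) : 1 - x%:C = (1 - x)%:C by rewrite rmorphB rmorph1.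
  under [X in csmooth X]funext do rewrite E.
  split; last exact: smooth_cst.
  by apply: smoothB; [exact: smooth_cst|exact: smooth_fst].
apply: csmoothD; apply: csmoothM => //; apply: csmooth_sum => j.
  apply: csmoothM => //; apply: csmoothM; first exact: csmoothX.
  by apply: csmoothX; exact: csmooth_conj.
by apply: csmoothM => //; exact: csmoothX.
Qed.

Lemma smooth_fmap : smooth fmap.
Proof.
have [sre sim] := csmooth_f_It; apply: smooth_row => k.
under [X in smooth X]funext do rewrite mxE.
by case: (k == 0).
Qed.

End FinalSetup.
(** * A lower bound for the Gram determinant *)

Lemma is_derive_scale_line (R : realType) (W : normedModType R) (x w : W) :
  is_derive (0 : R) 1 (fun u : R => x + u *: w) w.
Proof.
have cw : {for (0 : R), continuous (fun=> w)} by exact: cvg_cst.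
have D1 := is_deriveZf cw (is_derive_id (0 : R) 1) (is_derive_cst w (0 : R) 1).
apply: (is_derive_eq (is_deriveD (is_derive_cst x (0 : R) 1) D1)).
by rewrite add0r scaler0 addr0 scale1r.
Qed.

Section Regularity.
Variables (R : realType) (n : nat) (a b : 'I_n -> nat).
Local Notation C := R[i].
Local Notation V := 'rV[R]_(n + n).
Local Notation P := ('rV[R]_n * 'rV[R]_n)%type.
Local Notation F := (fmap a b).
Hypothesis ha : forall j, (1 <= a j)%N.

Lemma grad_cderiv (t : R) (v : V) (gam : nat -> C) (d : C) :
  has_cderiv (fun u : R => f_It a b t (\row_j (to_complex v 0 j + u%:C * (gam j * to_complex v 0 j)))) d ->
  exists w, dot (grad F 0 (t, v)) w = complex.Re d /\
            dot (grad F 1 (t, v)) w = complex.Im d.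
Proof.
move=> [dre dim]; have sF := @smooth_fmap R n a b.
pose w : V := to_real (\row_j (gam j * to_complex v 0 j)).
have lineE (u : R) : to_complex (v + u *: w) =
    \row_j (to_complex v 0 j + u%:C * (gam j * to_complex v 0 j)).
  by apply/rowP => j; rewrite to_complex_line to_realK !mxE.
have key k : is_derive (t, v) (0, w) (fun q : R * V => F q 0 k) (dot (grad F k (t, v)) w).
  rewrite dot_grad//; apply: (is_derive_linear_comp (L := @rV_coord R 2 k)).
    exact: (@coord_continuous _ _ _ 0 k).
  by apply: derivableP; apply: diff_derivable; exact: smooth_differentiable.
have key0 k : is_derive (0 : R) 1 (fun u : R => F (t, v + u *: w) 0 k) (dot (grad F k (t, v)) w).
  have := (is_derive_line (fun q : R * V => F q 0 k) (t, v) (0 : R, w) 0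
    (dot (grad F k (t, v)) w)).1.
  rewrite scale0r addr0 => /(_ (key k)); congr (is_derive _ _ _ _).
  apply: funext => u; congr (F _ 0 k); congr pair => /=.
  by rewrite scaler0 addr0.
exists w; split.
  have [_ <-] := key0 0; have [_ <-] := dre.
  apply: (congr1 (fun f : R -> R => 'D_(1 : R) f (0 : R))).
  by apply: funext => u; rewrite mxE /= lineE.
have [_ <-] := key0 1; have [_ <-] := dim.
apply: (congr1 (fun f : R -> R => 'D_(1 : R) f (0 : R))).
by apply: funext => u; rewrite mxE /= lineE.
Qed.

Definition entries (y : 'rV[R]_2) : R * R := (y 0 0, y 0 1).
Lemma entries_linear : linear entries.
Proof. by move=> c x y; rewrite /entries !mxE. Qed.
HB.instance Definition _ :=
  GRing.isLinear.Build R 'rV[R]_2 (R * R)%type _ entries entries_linear.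

Lemma real_diffE (t : R) (z v : 'rV[C]_n) : real_diff (f_It a b t) z v =
  (dot (grad F 0 (t, to_real z)) (to_real v), dot (grad F 1 (t, to_real z)) (to_real v)).
Proof.
have sF := @smooth_fmap R n a b.
pose io (p : P) : R * V := (t, real_row p).
have sio : smooth io by apply: smooth_pair; [exact: smooth_cst|exact: smooth_real_row].
rewrite /real_diff.
have -> : (fun p : P => (complex.Re (f_It a b t (complexify p)),
    complex.Im (f_It a b t (complexify p))) : R * R) = entries \o (F \o io).
  apply: funext => p; rewrite /entries /= !mxE /=.
  by rewrite /to_complex real_rowK.
have sL : smooth (entries : 'rV[R]_2 -> R * R).
  by apply: smooth_pair; apply: smooth_entry; exact: smooth_id.
have sall : smooth (entries \o (F \o io)).
  by apply: (smooth_comp (f := F \o io)) => //; exact: (smooth_comp sio sF).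
have dio : is_derive (realify z) (realify v) io (0, to_real v).
  have E (u : R) : io (realify z + u *: realify v) = io (realify z) + u *: (0, to_real v).
    by rewrite /io real_row_line; congr pair; rewrite /= scaler0 addr0.
  have H : is_derive (0 : R) 1 (fun u : R => io (realify z) + u *: (0 : R, to_real v)) (0, to_real v).
    apply: is_derive_scale_line.
  have := (is_derive_line io (realify z) (realify v) 0 (0, to_real v)).2.
  rewrite scale0r addr0; apply.
  by under [X in is_derive _ _ X]funext do rewrite E.
have dF : differentiable F (io (realify z)) by exact: smooth_differentiable.
have D1 := is_derive_comp dio dF.
have cL : continuous (entries : {linear 'rV[R]_2 -> (R * R)%type}) by exact: smooth_continuous sL.
have [_ D2] := is_derive_linear_comp cL D1.
rewrite -deriveE; last exact: smooth_differentiable.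
by rewrite [LHS]D2 -deriveE// !dot_grad.
Qed.

Variables (r eta0 : R).
Hypotheses (r0 : 0 < r) (eta00 : 0 < eta0).
Hypothesis htr : forall (t : R) (eta : C), 0 <= t <= 1 -> `|eta| <= eta0%:C ->
  fiber_transverse_sphere (f_It a b t) eta r.

(** The values that the isotopy must preserve: those of modulus at most [eta0]
    on the sphere, and those of modulus [eta0] in the whole ball. *)
Definition relevant (on_sphere : bool) (y : 'rV[R]_2) : Prop :=
  (on_sphere /\ sqmod y <= eta0 ^+ 2) \/ sqmod y = eta0 ^+ 2.

(** Transversality is used on the sphere, the diagonal fields inside. *)
Lemma gdet_relevant_gt0 (t : R) (v : V) : 0 <= t <= 1 ->
  fiberwise F r relevant t v -> 0 < gdet F r (t, v).
Proof.
move=> t01 [vb rel]; apply: gdet_gt0 => // y0 y1 /=.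
have [vr|vr] := eqVneq (dot v v) (r ^+ 2).
  have le : sqmod (F (t, v)) <= eta0 ^+ 2.
    by case: rel => [[_ //]|->].
  rewrite -(to_complexK v) in vr le *; set z := to_complex v in vr le *.
  have sz : sphere r z by apply/sphereE.
  have le' : `|f_It a b t z| <= eta0%:C by rewrite norm_le.
  have [surj dec] := htr t01 le' erefl sz.
  have [u uy] := surj (y0, y1); have [v' [w [uE dv zw]]] := dec u.
  exists (to_real w); move: uy dv; rewrite uE !real_diffE to_realD !dotDr.
  move=> [<- <-] [-> ->]; rewrite !add0r; split=> // _.
  by rewrite dot_to_real.
have fE : sqmod (F (t, v)) = eta0 ^+ 2.
  by case: rel => // -[]; rewrite (negbTE vr).
have [g1 H1] := radial_field b ha (to_complex v) t01.
have [g2 H2] := angular_field b ha t (to_complex v).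
have [w1 [w1r w1i]] := grad_cderiv H1.
have [w2 [w2r w2i]] := grad_cderiv H2.
move: fE; rewrite /sqmod !mxE /=.
move: w1r w1i w2r w2i; case: (f_It a b t (to_complex v)) => x y /= w1r w1i w2r w2i fE.
(* the fields realize the values [(x, y)] and [(- y, x)], a basis of R^2 *)
have s0 : x ^+ 2 + y ^+ 2 != 0 by rewrite fE expf_neq0// gt_eqF.
exists (((y0 * x + y1 * y) / (x ^+ 2 + y ^+ 2)) *: w1 +
        ((y1 * x - y0 * y) / (x ^+ 2 + y ^+ 2)) *: w2).
split; last by move=> E; rewrite E eqxx in vr.
  by rewrite !dotE w1r w2r; field.
by rewrite !dotE w1i w2i; field.
Qed.

Lemma closed_smooth_le (W : normedModType R) (f : W -> R) c : smooth f ->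
  closed [set x | f x <= c].
Proof.
move=> sf; apply: (@closed_comp _ _ f [set y | y <= c]) => [x _|].
  exact: smooth_continuous sf x.
exact: closed_le.
Qed.

Lemma closed_smooth_eq (W : normedModType R) (f : W -> R) c : smooth f ->
  closed [set x | f x = c].
Proof.
move=> sf; apply: (@closed_comp _ _ f [set y | y = c]) => [x _|].
  exact: smooth_continuous sf x.
exact: closed_eq.
Qed.

Lemma gdet_bounded_below : exists2 delta : R, 0 < delta &
  forall s z, 0 <= s <= 1 -> fiberwise F r relevant s z ->
    2 * delta <= gdet F r (s, z).
Proof.
have sF := @smooth_fmap R n a b.
have sq : smooth (fun p : R * V => dot p.2 p.2).
  by apply: smooth_dot; exact: smooth_snd.
have sm : smooth (fun p : R * V => sqmod (F p)).
  by apply: smoothD; apply: smoothM; exact: smooth_entry.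
pose S : set (R * V) := ([set p | dot p.2 p.2 = r ^+ 2] `&`
   [set p | sqmod (F p) <= eta0 ^+ 2]) `|` [set p | sqmod (F p) = eta0 ^+ 2].
pose K := S `&` cylinder r.
have cK : compact K.
  apply: (subclosed_compact _ (compact_cylinder (N := n + n) r0)); last first.
    by move=> p [].
  apply: closedI; last exact: compact_closed (compact_cylinder r0).
  apply: closedU; last exact: closed_smooth_eq.
  by apply: closedI; [exact: closed_smooth_eq|exact: closed_smooth_le].
have KP s z : 0 <= s <= 1 -> fiberwise F r relevant s z -> K (s, z).
  move=> s01 [zb rel]; split; last by split=> //=; rewrite in_itv.
  by case: rel => [[/eqP ? ?]|?]; [left|right].
have PK p : K p -> 0 < gdet F r p.
  case: p => s z [rel [/= s01 zb]]; apply: gdet_relevant_gt0.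
    by move: s01; rewrite in_itv.
  by split=> //; case: rel => [[/eqP ? ?]|?]; [left|right].
have [K0|K0] := eqVneq K set0.
  by exists 1 => // s z s01 /(KP _ _ s01); rewrite K0.
have sG : smooth (gdet F r) := smooth_gdet r sF (@smooth_id R (R * V)%type).
have cG : continuous (gdet F r) by exact: smooth_continuous sG.
have cD : {within K, continuous (gdet F r)} by exact: continuous_subspaceT cG.
have [c] := compact_EVT_min ((set0P _).1 K0) cK cD; rewrite inE => Kc Hc.
have c0 := PK c Kc; move: (gdet F r c) c0 Hc => g g0 Hc.
exists (g / 2) => [|s z s01 fz]; first by rewrite divr_gt0.
rewrite mulrC divfK ?pnatr_eq0//; apply: Hc.
by rewrite inE; exact: KP.
Qed.

End Regularity.
(** * The isotopy and the equivalence of fibrations *)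

Section Assembly.
Variables (R : realType) (n : nat) (a b : 'I_n -> nat).
Local Notation C := R[i].
Local Notation V := 'rV[R]_(n + n).
Local Notation P := ('rV[R]_n * 'rV[R]_n)%type.
Local Notation F := (fmap a b).
Variables (r eta0 : R).
Hypotheses (r0 : 0 < r) (eta00 : 0 < eta0).
Variables (G Gi : R -> V -> V).
Hypotheses (sG : smooth_map (unit_ball r) (fun q => G q.1 q.2))
  (sGi : forall t, 0 <= t <= 1 -> smooth_map (eball r) (Gi t))
  (HG : forall t, 0 <= t <= 1 ->
     transports F r (relevant eta0) 0 t (G t) (Gi t)).

Let h (t : R) (z : 'rV[C]_n) : 'rV[C]_n := to_complex (G t (to_real z)).
Let k (t : R) (z : 'rV[C]_n) : 'rV[C]_n := to_complex (Gi t (to_real z)).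

Let realify_to_complex v : realify (to_complex v) = real_pair v :> P.
Proof. by rewrite /to_complex complexifyK. Qed.

Let to_real_complexify p : to_real (complexify p) = real_row p :> V.
Proof. by rewrite /to_real complexifyK. Qed.

Lemma smooth_conjugate (W : normedModType R) (A : set W) (f : W -> V) :
  smooth_map A f -> smooth_map A (fun x => realify (to_complex (f x))).
Proof.
move=> sf; have -> : (fun x => realify (to_complex (f x))) = @real_pair R n \o f.
  by apply: funext => x; rewrite realify_to_complex.
apply: (smooth_map_comp (B := setT)) => //.
by apply: smooth_smooth_map; exact: smooth_real_pair.
Qed.

Lemma smooth_h : smooth_map [set q : R * P | 0 <= q.1 <= 1 /\
    (@realify R n @` sphere r) q.2] (fun q => realify (h q.1 (complexify q.2))).
Proof.
apply: smooth_conjugate.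
apply: (smooth_map_comp (B := unit_ball r)
  (f := fun q : R * P => (q.1, to_real (complexify q.2))) _ _ sG).
  move=> [t p] [/= t01 [z /sphereE zr <-]]; split=> //=.
  by rewrite realifyK /eball /= zr.
apply: smooth_smooth_map; apply: smooth_pair; first exact: smooth_fst.
under [X in smooth X]funext do rewrite to_real_complexify.
by apply: (smooth_comp _ (@smooth_real_row R n)); exact: smooth_snd.
Qed.

Lemma diffeo_h (t : R) (A B : set 'rV[C]_n) : 0 <= t <= 1 ->
  (forall z, A z -> enorm z <= r) -> (forall z, B z -> enorm z <= r) ->
  (forall z, A z -> B (h t z)) -> (forall z, B z -> A (k t z)) ->
  diffeomorphismC A B (h t).
Proof.
move=> t01 Ar Br AB BA.
have sub (X : set 'rV[C]_n) (g : V -> V) : (forall z, X z -> enorm z <= r) ->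
    smooth_map (eball r) g ->
    smooth_map (@realify R n @` X) (fun p => realify (to_complex (g (to_real (complexify p))))).
  move=> Xr sg; apply: smooth_conjugate.
  apply: (smooth_map_comp (B := eball r) (f := fun p => to_real (complexify p)) _ _ sg).
    by move=> _ [z /Xr zr <-]; rewrite realifyK /eball /= -enorm_le.
  apply: smooth_smooth_map.
  by under [X in smooth X]funext do rewrite to_real_complexify; exact: smooth_real_row.
exists (fun p => realify (k t (complexify p))); split.
- move=> _ [z Az <-] /=; rewrite realifyK; split; first by exists (h t z) => //; exact: AB.
  rewrite realifyK /k /h to_complexK.
  have zb : eball r (to_real z) by rewrite /eball /= -enorm_le//; exact: Ar.
  by have [[_ _ -> _] _] := HG t01 zb; rewrite to_realK.
- move=> _ [z Bz <-] /=; rewrite realifyK; split; first by exists (k t z) => //; exact: BA.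
  rewrite realifyK /k /h to_complexK.
  have zb : eball r (to_real z) by rewrite /eball /= -enorm_le//; exact: Br.
  by have [_ [_ _ -> _]] := HG t01 zb; rewrite to_realK.
- apply: (sub A (G t) Ar).
  apply: (smooth_map_comp (B := unit_ball r) (f := fun v => (t, v)) _ _ sG) => //.
  by apply: smooth_smooth_map; apply: smooth_pair; [exact: smooth_cst|exact: smooth_id].
- exact: (sub B (Gi t) Br (sGi t01)).
Qed.

Lemma h_facts (t : R) (z : 'rV[C]_n) : 0 <= t <= 1 -> enorm z <= r ->
  [/\ enorm (h t z) <= r, sphere r (h t z) <-> sphere r z &
    ((sphere r z /\ `|f_It a b 0 z| <= eta0%:C) \/ `|f_It a b 0 z| = eta0%:C ->
     f_It a b t (h t z) = f_It a b 0 z)].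
Proof.
move=> t01; rewrite !enorm_le// => zb; have [[gb gs _ gF] _] := HG t01 zb.
rewrite /h to_complexK; split=> //.
  rewrite !sphereE// to_complexK; split=> /eqP; first by rewrite gs => /eqP.
  by rewrite -gs => /eqP.
move=> rel; apply: fmap_eq; rewrite to_complexK; apply: gF; split=> //.
case: rel => [[zs fz]|fz]; [left|right]; last exact/norm_eq.
by split; [apply/eqP/sphereE|rewrite -norm_le].
Qed.

Lemma k_facts (t : R) (z : 'rV[C]_n) : 0 <= t <= 1 -> enorm z <= r ->
  [/\ enorm (k t z) <= r, sphere r (k t z) <-> sphere r z, h t (k t z) = z &
    ((sphere r z /\ `|f_It a b t z| <= eta0%:C) \/ `|f_It a b t z| = eta0%:C ->
     f_It a b 0 (k t z) = f_It a b t z)].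
Proof.
move=> t01; rewrite !enorm_le// => zb; have [_ [gb gs gK gF]] := HG t01 zb.
rewrite /h /k to_complexK gK to_realK; split=> //.
  rewrite !sphereE// to_complexK; split=> /eqP; first by rewrite gs => /eqP.
  by rewrite -gs => /eqP.
move=> rel; apply: fmap_eq; rewrite to_complexK; apply: gF; split=> //.
case: rel => [[zs fz]|fz]; [left|right]; last exact/norm_eq.
by split; [apply/eqP/sphereE|rewrite -norm_le].
Qed.

End Assembly.

Unset Implicit Arguments.

Theorem mainTheorem2 (R : realType) (n : nat) (a b : 'I_n -> nat)
    (hn : (1 <= n)%N) (ha : forall j, (1 <= a j)%N)
    (hg : isolated_singularity_at_origin (g_I (R := R) a))
    (r eta0 : R) (hr : 0 < r) (heta0 : 0 < eta0)
    (htr : forall (t : R) (eta : R[i]), 0 <= t <= 1 -> `|eta| <= eta0%:C ->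
       fiber_transverse_sphere (f_It a b t) eta r) :
  (exists h : R -> 'rV[R[i]]_n -> 'rV[R[i]]_n,
     link_isotopy a b r h /\
     (forall (t : R) (z : 'rV[R[i]]_n), 0 <= t <= 1 -> sphere r z ->
        `|f_It a b 0 z| <= eta0%:C -> f_It a b t (h t z) = f_It a b 0 z)) /\
  (forall t : R, 0 <= t <= 1 ->
     fibrations_equivalent (milnor_tube a b 0 eta0 r) (milnor_tube a b t eta0 r)
       (f_It a b 0) (f_It a b t)).
Proof.
have [delta delta0 Hdelta] := gdet_bounded_below ha hr heta0 htr.
have [G [Gi [sG sGi HG]]] :=
  isotopy_exists (@smooth_fmap R n a b) hr delta0 Hdelta.
pose h t z := to_complex (G t (to_real z)) : 'rV[R[i]]_n.
pose k t z := to_complex (Gi t (to_real z)) : 'rV[R[i]]_n.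
have hf := h_facts hr heta0 HG; have kf := k_facts hr heta0 HG.
have sle (z : 'rV[R[i]]_n) : sphere r z -> enorm z <= r by move=> ->.
have c0 : `|0 : R[i]| <= eta0%:C by rewrite normr0 ler0c ltW.
split; last first.
  move=> t t01; exists (h t); split.
    apply: (diffeo_h hr sG sGi HG t01) => [z []|z []|z [fz zr]|z [fz zr]] //.
      have [hr' _ hE] := hf t z t01 zr.
      by split=> //; rewrite /= hE//; right.
    have [kr _ _ kE] := kf t z t01 zr.
    by split=> //; rewrite /= kE//; right.
  by move=> z [fz zr]; have [_ _ ->] := hf t z t01 zr => //; right.
exists h; split; last first.
  by move=> t z t01 zs fz; have [_ _ ->] := hf t z t01 (sle _ zs) => //; left.
split; first exact: (smooth_h hr sG).
move=> t t01; split.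
  apply: (diffeo_h hr sG sGi HG t01) => // z zs.
    by have [_ [_ H] _] := hf t z t01 (sle _ zs); exact: H.
  by have [_ [_ H] _ _] := kf t z t01 (sle _ zs); exact: H.
apply/seteqP; split=> [_ [z [/= fz zs] <-]|z [/= fz zs]].
  have [_ [_ hs] hE] := hf t z t01 (sle _ zs).
  split; last exact: hs.
  by rewrite /= hE//; left; rewrite fz.
have [_ [_ ks] kK kE] := kf t z t01 (sle _ zs).
exists (k t z) => //; split; last exact: ks.
by rewrite /= kE//; left; rewrite fz.
Qed.
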